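(* The pro-homology $\mathbf{H}_*$ does not satisfy the Universal Coefficients Formula (UCF) in the class $\mathbf{AB}$ of all abelian groups.
   Context: Pro-categories. For a category $\mathbf{C}$, objects of $\mathbf{Pro}(\mathbf{C})$ are functors $\mathbf{X}=(X_i)_{i\in\mathbf{I}}:\mathbf{I}\to\mathbf{C}$ with $\mathbf{I}$ a small cofiltrant category, and $Hom_{\mathbf{Pro}(\mathbf{C})}(\mathbf{X},\mathbf{Y})=\varprojlim_{j}\varinjlim_{i}Hom_{\mathbf{C}}(X_i,Y_j)$. $\mathbf{Mod}(\mathbb{Z})$ is the category of abelian groups, $\mathbf{Pro}(\mathbb{Z}):=\mathbf{Pro}(\mathbf{Mod}(\mathbb{Z}))$ (an abelian category). Tensor product and Tor. For $\mathbf{P}\in\mathbf{Pro}(\mathbb{Z})$, $M\in\mathbf{Mod}(\mathbb{Z})$, $\mathbf{P}\otimes_{\mathbb{Z}}M\in\mathbf{Pro}(\mathbb{Z})$ is the pro-group with $Hom_{\mathbf{Pro}(\mathbb{Z})}(\mathbf{P}\otimes_{\mathbb{Z}}M,\mathbf{N})\simeq Hom_{\mathbb{Z}}(M,Hom_{\mathbf{Pro}(\mathbb{Z})}(\mathbf{P},\mathbf{N}))$ naturally in $\mathbf{N}$; concretely, if $M=\mathrm{coker}(\mathbb{Z}^{(Y)}\to\mathbb{Z}^{(X)})$ is given by a matrix of integers, then $\mathbf{P}\otimes_{\mathbb{Z}}M=\mathrm{coker}(\bigoplus_Y\mathbf{P}\to\bigoplus_X\mathbf{P})$ with the same matrix,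 direct sums taken in $\mathbf{Pro}(\mathbb{Z})$. $\mathbf{Tor}^{\mathbb{Z}}_n(\mathbf{P},G):=H_n(\mathbf{P}\otimes_{\mathbb{Z}}Q_* )$ (homology in $\mathbf{Pro}(\mathbb{Z})$) for a projective resolution $Q_*\to G$. Strong polyhedral expansions and strong shape. A strong polyhedral expansion of a space $X$ is a morphism $p=(p_i):X\to\mathbf{X}=(X_i)_{i\in\mathbf I}$ in $\mathbf{Pro}(\mathbf{TOP})$, with all $X_i$ of the homotopy type of polyhedra, such that for every polyhedron $P$: (S1) each map $f:X\to P$ is homotopic to $hp_i$ for some $i$ and some $h:X_i\to P$; (S2) if $h_0,h_1:X_i\to P$ and $F:X\times[0,1]\to P$ is a homotopy from $h_0p_i$ to $h_1p_i$, there are $i'\to i$ in $\mathbf I$ and a homotopy $H$ from $h_0p_{ii'}$ to $h_1p_{ii'}$ on $X_{i'}$ ($p_{ii'}:X_{i'}\to X_i$ the bonding map) with $H(p_{i'}\times1)$ homotopic to $F$ rel $X\times\{0,1\}$. The strong shape category $\mathbf{SSh}$ has topological spaces as objects and is identified, via strong polyhedral expansions, with a full subcategory of the category of fractions $\mathbf{Pro}(\mathbf{POL})[\Sigma^{-1}]$, where $\mathbf{POL}$ is the category of spaces of the homotopy type of polyhedra and $\Sigma$ is the class of special morphisms: $(\varphi,\psi):(X_i)_{\mathbf I}\to(Y_j)_{\mathbf J}$ with $\varphi:\mathbf J\to\mathbf I$ a cofinal functor and $\psi:\mathbf X\circ\varphi\to\mathbf Y$ a natural transformation consisting of homotopy equivalences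 $X_{\varphi(j)}\to Y_j$. Pro-homology. Let $X\to\mathbf X=(X_i)_{i\in\mathbf I}$ be a strong polyhedral expansion. Then $\mathbf H_n(X,G):=(H_n(X_i,G))_{i\in\mathbf I}\in\mathbf{Pro}(\mathbb Z)$ (singular homology), a functor on $\mathbf{SSh}\times\mathbf{Mod}(\mathbb Z)$ independent of the choice of the expansion. Pairing $\mathbf H_n(X,\mathbb Z)\otimes_{\mathbb Z}G\to\mathbf H_n(X,G)$. For $a\in G$ the chain maps $C_*(X_i,\mathbb Z)\to C_*(X_i,G)$, $c\mapsto c\otimes a$, induce $\bar a_*:\mathbf H_n(X,\mathbb Z)\to\mathbf H_n(X,G)$; the pairing is the adjoint of the homomorphism $G\to Hom_{\mathbf{Pro}(\mathbb Z)}(\mathbf H_n(X,\mathbb Z),\mathbf H_n(X,G))$, $a\mapsto\bar a_*$. UCF. The theory $h_*=\mathbf H_*$ satisfies UCF in a class $\mathfrak C$ of abelian groups iff for all $n\in\mathbb Z$, all topological spaces $X$ and all $G\in\mathfrak C$: (i) the pairing $h_n(X,\mathbb Z)\otimes_{\mathbb Z}G\to h_n(X,G)$ is a monomorphism; (ii) its cokernel is naturally (in $X\in\mathbf{SSh}$ and $G\in\mathfrak C$) isomorphic to $\mathbf{Tor}_1^{\mathbb Z}(h_{n-1}(X,\mathbb Z),G)$. *)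

(* Defs.v *)
From Stdlib Require Import Relation_Operators.
From HB Require Import structures.
From mathcomp Require Import all_boot all_order all_algebra finmap.
From mathcomp Require Import generic_quotient ring_quotient.
From mathcomp Require Import all_classical all_reals all_analysis.
From mathcomp Require Import -(notations) monalg.

Set Implicit Arguments.
Unset Strict Implicit.
Unset Printing Implicit Defensive.

Import Order.TTheory GRing.Theory Num.Theory.
Import numFieldNormedType.Exports.

Local Open Scope classical_set_scope.
Local Open Scope ring_scope.
Local Open Scope quotient_scope.

(* Equality of morphisms is an equivalence relation [=c], so that
   morphisms of pro-categories and of categories of fractions can be given by
   representatives. *)

Reserved Notation "f =c g" (at level 70, no associativity).
Reserved Notation "g \oc f" (at level 40, left associativity).

Record category := Category {
  obj :> Type;
  hom : obj -> obj -> Type;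
  heq : forall A B, hom A B -> hom A B -> Prop;
  idc : forall A, hom A A;
  ccomp : forall A B C, hom B C -> hom A B -> hom A C;
  heq_refl : forall A B (f : hom A B), heq f f;
  heq_sym : forall A B (f g : hom A B), heq f g -> heq g f;
  heq_trans : forall A B (f g h : hom A B), heq f g -> heq g h -> heq f h;
  ccomp_heq : forall A B C (g g' : hom B C) (f f' : hom A B),
    heq g g' -> heq f f' -> heq (ccomp g f) (ccomp g' f');
  compcA : forall A B C D (h : hom C D) (g : hom B C) (f : hom A B),
    heq (ccomp h (ccomp g f)) (ccomp (ccomp h g) f);
  compc1 : forall A B (f : hom A B), heq (ccomp f (idc A)) f;
  comp1c : forall A B (f : hom A B), heq (ccomp (idc B) f) f }.

Arguments hom {c}.
Arguments heq {c A B}.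
Arguments idc {c}.
Arguments ccomp {c A B C}.

Notation "f =c g" := (heq f g).
Notation "g \oc f" := (ccomp g f).

Definition is_mono (C : category) (A B : C) (f : hom A B) :=
  forall (Z : C) (g h : hom Z A), f \oc g =c f \oc h -> g =c h.

Definition inverse_of (C : category) (A B : C) (f : hom A B) (g : hom B A) :=
  g \oc f =c idc A /\ f \oc g =c idc B.

Definition is_iso (C : category) (A B : C) (f : hom A B) :=
  exists g, inverse_of f g.

Record functor (C D : category) := Functor {
  fobj :> C -> D;
  fmor : forall A B, hom A B -> hom (fobj A) (fobj B);
  fmor_heq : forall A B (f g : hom A B), f =c g -> fmor f =c fmor g;
  fmor1 : forall A, fmor (idc A) =c idc (fobj A);
  fmor_comp : forall A B Z (g : hom B Z) (f : hom A B),
    fmor (g \oc f) =c fmor g \oc fmor f }.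

Record nat_trans (C D : category) (F G : functor C D) := NatTrans {
  ntrans :> forall A, hom (F A) (G A);
  ntransP : forall A B (f : hom A B),
    fmor G f \oc ntrans A =c ntrans B \oc fmor F f }.

Section FullSubcategory.
Variables (C : category) (P : C -> Prop).

Definition full_sub : category := {|
  obj := {A : C | P A};
  hom := fun A B => hom (sval A) (sval B);
  heq := fun A B => @heq C _ _;
  idc := fun A => idc (sval A);
  ccomp := fun A B Z => @ccomp C _ _ _;
  heq_refl := fun A B => @heq_refl C _ _;
  heq_sym := fun A B => @heq_sym C _ _;
  heq_trans := fun A B => @heq_trans C _ _;
  ccomp_heq := fun A B Z => @ccomp_heq C _ _ _;
  compcA := fun A B Z T => @compcA C _ _ _ _;
  compc1 := fun A B => @compc1 C _ _;
  comp1c := fun A B => @comp1c C _ _ |}.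

Definition full_restr (D : category) (F : functor C D) : functor full_sub D :=
  @Functor full_sub D (fun A => F (sval A)) (fun A B => @fmor _ _ F _ _)
    (fun A B => @fmor_heq _ _ F _ _) (fun A => fmor1 F (sval A))
    (fun A B Z => @fmor_comp _ _ F _ _ _).

Definition full_restr_nat (D : category) (F G : functor C D)
    (t : nat_trans F G) : nat_trans (full_restr F) (full_restr G) :=
  @NatTrans full_sub D (full_restr F) (full_restr G) (fun A => t (sval A))
    (fun A B => @ntransP _ _ _ _ t _ _).

End FullSubcategory.

(* Index categories. Their hom-sets are compared by Leibniz equality. *)
Record small_cat := SmallCat {
  sobj :> Type;
  shom : sobj -> sobj -> Type;
  sid : forall i, shom i i;
  scomp : forall i j k, shom j k -> shom i j -> shom i k;
  scompA : forall i j k l (c : shom k l) (b : shom j k) (a : shom i j),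
    scomp c (scomp b a) = scomp (scomp c b) a;
  scomp1 : forall i j (a : shom i j), scomp a (sid i) = a;
  s1comp : forall i j (a : shom i j), scomp (sid j) a = a }.

Arguments shom {s}.
Arguments sid {s}.
Arguments scomp {s i j k}.

Definition cofiltrant (I : small_cat) :=
  [/\ inhabited I,
      forall i j : I, exists k, inhabited (shom k i) /\ inhabited (shom k j) &
      forall (i j : I) (a b : shom i j), exists k (c : shom k i),
        scomp a c = scomp b c].

Record small_functor (J I : small_cat) := SmallFunctor {
  sfobj :> J -> I;
  sfmor : forall j j', shom j j' -> shom (sfobj j) (sfobj j');
  sfmor1 : forall j, sfmor (sid j) = sid (sfobj j);
  sfmor_comp : forall j j' j'' (b : shom j' j'') (a : shom j j'),
    sfmor (scomp b a) = scomp (sfmor b) (sfmor a) }.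

(* Cofinality in the sense relevant to inverse systems: for every [i] the comma
   category of the arrows [phi j -> i] is nonempty and connected. *)
Definition comma_step (J I : small_cat) (phi : small_functor J I) (i : I)
    (x y : {j : J & shom (phi j) i}) :=
  exists c : shom (tag x) (tag y), tagged x = scomp (tagged y) (sfmor phi c).

Definition cofinal (J I : small_cat) (phi : small_functor J I) :=
  forall i, inhabited {j : J & shom (phi j) i} /\
    forall x y : {j : J & shom (phi j) i},
      clos_refl_sym_trans _ (@comma_step _ _ phi i) x y.

Record diagram (I : small_cat) (C : category) := Diagram {
  dobj :> I -> C;
  dmor : forall i j, shom i j -> hom (dobj i) (dobj j);
  dmor1 : forall i, dmor (sid i) =c idc (dobj i);
  dmor_comp : forall i j k (b : shom j k) (a : shom i j),
    dmor (scomp b a) =c dmor b \oc dmor a }.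

Lemma cofiltrant_square (I : small_cat) (i k k' : I)
    (a : shom k i) (b : shom k' i) : cofiltrant I ->
  exists l (c : shom l k) (d : shom l k'), scomp a c = scomp b d.
Proof.
case=> _ Ib Ie; have [m [[p] [q]]] := Ib k k'.
have [l [c E]] := Ie _ _ (scomp a p) (scomp b q).
by exists l, (scomp p c), (scomp q c); rewrite !scompA.
Qed.

Section Pro.
Variable C : category.

Record pro_obj := ProObj {
  pro_idx : small_cat;
  pro_idxP : cofiltrant pro_idx;
  pro_diag :> diagram pro_idx C }.

Implicit Types (X Y Z : pro_obj) (A B : C).

(* Equality in the colimit over [i] of the sets [hom (X i) A]. *)
Definition germ_eq (X : pro_obj) (A : C) (i i' : pro_idx X)
    (f : hom (X i) A) (f' : hom (X i') A) :=
  exists k (a : shom k i) (b : shom k i'),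
    f \oc dmor X a =c f' \oc dmor X b.

Lemma germ_eq_heq X A i (f f' : hom (X i) A) : f =c f' ->
  @germ_eq X A i i f f'.
Proof. by move=> E; exists i, (sid i), (sid i); apply: ccomp_heq E (heq_refl _). Qed.

Lemma germ_eq_refl X A i (f : hom (X i) A) : @germ_eq X A i i f f.
Proof. exact/germ_eq_heq/heq_refl. Qed.

Lemma germ_eq_sym X A i i' (f : hom (X i) A) (f' : hom (X i') A) :
  germ_eq f f' -> germ_eq f' f.
Proof. by case=> k [a [b E]]; exists k, b, a; apply: heq_sym. Qed.

Lemma germ_eq_restr X A i k (f : hom (X i) A) (a : shom k i) :
  germ_eq (f \oc dmor X a) f.
Proof.
exists k, (sid k), a; apply: heq_trans (compc1 _).
exact: ccomp_heq (heq_refl _) (dmor1 _ _).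
Qed.

Lemma germ_comp_restr X A i k l (f : hom (X i) A) (a : shom k i) (c : shom l k) :
  f \oc dmor X (scomp a c) =c f \oc dmor X a \oc dmor X c.
Proof.
apply: heq_trans (compcA _ _ _).
exact: ccomp_heq (heq_refl _) (dmor_comp _ _ _).
Qed.

Lemma germ_eq_trans X A i1 i2 i3 (f1 : hom (X i1) A) (f2 : hom (X i2) A)
    (f3 : hom (X i3) A) : germ_eq f1 f2 -> germ_eq f2 f3 -> germ_eq f1 f3.
Proof.
case=> k [a [b E]] [k' [c [d E']]].
have [l [e [g Eeg]]] := cofiltrant_square b c (pro_idxP X).
exists l, (scomp a e), (scomp d g).
apply: heq_trans (germ_comp_restr _ _ _) _.
apply: heq_trans (ccomp_heq E (heq_refl _)) _.
apply: heq_trans (heq_sym (germ_comp_restr _ _ _)) _; rewrite Eeg.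
apply: heq_trans (germ_comp_restr _ _ _) _.
apply: heq_trans (ccomp_heq E' (heq_refl _)) _.
exact/heq_sym/germ_comp_restr.
Qed.

Lemma germ_eq_postcomp X A B (g : hom A B) i i' (f : hom (X i) A)
    (f' : hom (X i') A) : germ_eq f f' -> germ_eq (g \oc f) (g \oc f').
Proof.
case=> k [a [b E]]; exists k, a, b.
apply: heq_trans (heq_sym (compcA _ _ _)) _.
apply: heq_trans (ccomp_heq (heq_refl _) E) _.
exact: compcA.
Qed.

(* An element of the limit over [j] of the colimits over [i] of the sets
   [hom (X i) (Y j)], given by a representative for each [j]. *)
Record pro_hom (X Y : pro_obj) := ProHom {
  ph_idx : pro_idx Y -> pro_idx X;
  ph_mor :> forall j, hom (X (ph_idx j)) (Y j);
  ph_compat : forall j j' (c : shom j j'),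
    germ_eq (dmor Y c \oc ph_mor j) (ph_mor j') }.

Definition pro_heq X Y (f g : pro_hom X Y) := forall j, germ_eq (f j) (g j).

Lemma pro_id_subproof X j j' (c : shom j j') :
  @germ_eq X (X j') j j' (dmor X c \oc idc (X j)) (idc (X j')).
Proof.
exists j, (sid j), c.
apply: heq_trans (ccomp_heq (compc1 _) (dmor1 _ _)) _.
apply: heq_trans (compc1 _) _.
exact/heq_sym/comp1c.
Qed.

Definition pro_id X : pro_hom X X :=
  @ProHom X X id (fun j => idc (X j)) (@pro_id_subproof X).

Lemma germ_eq_precomp X Y (f : pro_hom X Y) A j j' (g : hom (Y j) A)
    (g' : hom (Y j') A) : germ_eq g g' -> germ_eq (g \oc f j) (g' \oc f j').
Proof.
have restr i k (h : hom (Y i) A) (a : shom k i) :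
    germ_eq (h \oc f i) (h \oc dmor Y a \oc f k).
  apply: germ_eq_sym; apply: germ_eq_trans (germ_eq_postcomp h (ph_compat f a)).
  exact/germ_eq_heq/heq_sym/compcA.
case=> k [a [b E]]; apply: germ_eq_trans (restr _ _ _ a) _.
apply: germ_eq_trans (germ_eq_sym (restr _ _ _ b)).
exact/germ_eq_heq/ccomp_heq/heq_refl.
Qed.

Lemma pro_comp_subproof X Y Z (g : pro_hom Y Z) (f : pro_hom X Y) k k'
    (c : shom k k') :
  germ_eq (dmor Z c \oc (g k \oc f (ph_idx g k))) (g k' \oc f (ph_idx g k')).
Proof.
apply: germ_eq_trans (germ_eq_precomp f (ph_compat g c)).
exact/germ_eq_heq/compcA.
Qed.

Definition pro_comp X Y Z (g : pro_hom Y Z) (f : pro_hom X Y) : pro_hom X Z :=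
  @ProHom X Z (fun k => ph_idx f (ph_idx g k))
    (fun k => g k \oc f (ph_idx g k)) (pro_comp_subproof g f).

Lemma pro_ccomp_heq X Y Z (g g' : pro_hom Y Z) (f f' : pro_hom X Y) :
  pro_heq g g' -> pro_heq f f' -> pro_heq (pro_comp g f) (pro_comp g' f').
Proof.
move=> Eg Ef k; apply: germ_eq_trans (germ_eq_precomp f (Eg k)) _.
exact/germ_eq_postcomp/Ef.
Qed.

Definition Pro : category := {|
  obj := pro_obj; hom := pro_hom; heq := pro_heq;
  idc := pro_id; ccomp := pro_comp;
  heq_refl := fun X Y f j => germ_eq_refl (f j);
  heq_sym := fun X Y f g E j => germ_eq_sym (E j);
  heq_trans := fun X Y f g h E E' j => germ_eq_trans (E j) (E' j);
  ccomp_heq := pro_ccomp_heq;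
  compcA := fun X Y Z T h g f j => germ_eq_heq (compcA (h j) _ _);
  compc1 := fun X Y f j => germ_eq_heq (compc1 (f j));
  comp1c := fun X Y f j => germ_eq_heq (comp1c (f j)) |}.

End Pro.

Section ProFunctor.
Variables C D : category.

Definition fmap_diag (F : functor C D) (I : small_cat) (X : diagram I C) :
  diagram I D.
Proof.
refine (@Diagram I D (fun i => F (X i)) (fun i j a => fmor F (dmor X a)) _ _).
- by move=> i; apply: heq_trans (fmor_heq F (dmor1 X i)) (fmor1 F _).
- move=> i j k b a.
  by apply: heq_trans (fmor_heq F (dmor_comp X b a)) (fmor_comp F _ _).
Defined.

Definition pro_fobj (F : functor C D) (X : Pro C) : Pro D :=
  ProObj (pro_idxP X) (fmap_diag F X).

Lemma germ_eq_fmor (F : functor C D) (X : Pro C) A i i' (f : hom (X i) A)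
    (f' : hom (X i') A) : germ_eq f f' ->
  @germ_eq D (pro_fobj F X) (F A) i i' (fmor F f) (fmor F f').
Proof.
case=> k [a [b E]]; exists k, a, b.
apply: heq_trans (heq_sym (fmor_comp _ _ _)) _.
by apply: heq_trans (fmor_heq F E) (fmor_comp _ _ _).
Qed.

Lemma pro_fmor_subproof (F : functor C D) (X Y : Pro C) (f : hom X Y) j j'
    (c : shom j j') :
  @germ_eq D (pro_fobj F X) (F (Y j')) _ _
    (fmor F (dmor Y c) \oc fmor F (f j)) (fmor F (f j')).
Proof.
apply: germ_eq_trans (germ_eq_fmor F (ph_compat f c)).
exact/germ_eq_heq/heq_sym/fmor_comp.
Qed.

Definition pro_fmor (F : functor C D) (X Y : Pro C) (f : hom X Y) :
    @hom (Pro D) (pro_fobj F X) (pro_fobj F Y) :=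
  @ProHom D (pro_fobj F X) (pro_fobj F Y) (ph_idx f)
    (fun j => fmor F (f j)) (pro_fmor_subproof F f).

Definition pro_functor (F : functor C D) : functor (Pro C) (Pro D) :=
  @Functor (Pro C) (Pro D) (pro_fobj F) (@pro_fmor F)
    (fun X Y f g E j => germ_eq_fmor F (E j))
    (fun X j => @germ_eq_heq D (pro_fobj F X) _ j _ _ (fmor1 F (X j)))
    (fun X Y Z g f j =>
      @germ_eq_heq D (pro_fobj F X) _ _ _ _ (fmor_comp F (g j) (f _))).

Lemma pro_trans_subproof (F G : functor C D) (t : nat_trans F G) (X : Pro C)
    (j j' : pro_idx X) (c : shom j j') :
  @germ_eq D (pro_fobj F X) (G (X j')) j j'
    (fmor G (dmor X c) \oc t (X j)) (t (X j')).
Proof.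
apply: germ_eq_trans (@germ_eq_restr _ (pro_fobj F X) _ _ _ (t (X j')) c).
exact/germ_eq_heq/ntransP.
Qed.

Definition pro_trans (F G : functor C D) (t : nat_trans F G) (X : Pro C) :
    hom (pro_functor F X) (pro_functor G X) :=
  @ProHom D (pro_fobj F X) (pro_fobj G X) id (fun j => t (X j))
    (@pro_trans_subproof F G t X).

End ProFunctor.

Definition Ab : category.
Proof.
refine (@Category zmodType (fun A B => {additive A -> B})
  (fun A B f g => f =1 g) (fun A => [the {additive A -> A} of idfun])
  (fun A B C g f => [the {additive A -> C} of g \o f]) _ _ _ _ _ _ _) => //.
- by move=> A B f g E x; rewrite E.
- by move=> A B f g h E E' x; rewrite E.
- by move=> A B C g g' f f' E E' x /=; rewrite E E'.
Defined.

Definition ProZ : category := Pro Ab.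

Definition surjectivec (A B : Ab) (f : hom A B) := forall y, exists x, f x = y.

Section ProZAdditive.
Implicit Types X Y : ProZ.

Lemma lower_bound_ex X (i i' : pro_idx X) :
  exists p : {k : pro_idx X & (shom k i * shom k i')%type}, True.
Proof.
by have [_ /(_ i i')[k [[a] [b]]] _] := pro_idxP X; exists (existT _ k (a, b)).
Qed.

Definition lower_bound X (i i' : pro_idx X) :
    {k : pro_idx X & (shom k i * shom k i')%type} :=
  projT1 (cid (lower_bound_ex i i')).

Definition germ_add X (A : Ab) (i i' k : pro_idx X) (a : shom k i)
    (b : shom k i') (f : hom (X i) A) (g : hom (X i') A) : hom (X k) A :=
  [the {additive X k -> A} of (f \oc dmor X a : {additive _ -> _}) \+
     (g \oc dmor X b : {additive _ -> _})].

Lemma germ_eq_common X (A A' : Ab) (k k' : pro_idx X) (f : hom (X k) A)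
    (f' : hom (X k') A) (g : hom (X k) A') (g' : hom (X k') A') :
  germ_eq f f' -> germ_eq g g' ->
  exists l (c : shom l k) (d : shom l k'),
    f \oc dmor X c =c f' \oc dmor X d /\ g \oc dmor X c =c g' \oc dmor X d.
Proof.
move=> [l [c [d E]]] [l' [c' [d' E']]].
have [m [e [e' Ee]]] := cofiltrant_square c c' (pro_idxP X).
have [_ _ /(_ _ _ (scomp d e) (scomp d' e'))[n [q Eq]]] := pro_idxP X.
have restr (B : Ab) (u : hom (X k) B) (u' : hom (X k') B) (r : pro_idx X)
    (s : shom r k) (t : shom r k') (v : shom n r) :
    u \oc dmor X s =c u' \oc dmor X t ->
    u \oc dmor X (scomp s v) =c u' \oc dmor X (scomp t v).
  move=> Euu'; apply: heq_trans (germ_comp_restr _ _ _) _.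
  apply: heq_trans (ccomp_heq Euu' (heq_refl _)) _.
  exact/heq_sym/germ_comp_restr.
exists n, (scomp c (scomp e q)), (scomp d (scomp e q)); split; first exact: restr.
rewrite [scomp c _]scompA Ee [scomp d _]scompA Eq -!scompA; exact: restr.
Qed.

Lemma germ_eq_add X (A : Ab) (i i' j j' k l : pro_idx X) (a : shom k i)
    (a' : shom k i') (b : shom l j) (b' : shom l j') (f : hom (X i) A)
    (f' : hom (X i') A) (g : hom (X j) A) (g' : hom (X j') A) :
  germ_eq f g -> germ_eq f' g' ->
  germ_eq (germ_add a a' f f') (germ_add b b' g g').
Proof.
have restr (s s' r r' : pro_idx X) (u : shom r s) (u' : shom r' s')
    (h : hom (X s) A) (h' : hom (X s') A) : germ_eq h h' ->
    germ_eq (h \oc dmor X u) (h' \oc dmor X u').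
  move=> E; apply: germ_eq_trans (germ_eq_restr _ _) _.
  exact: germ_eq_trans E (germ_eq_sym (germ_eq_restr _ _)).
move=> /(restr _ _ _ _ a b) E /(restr _ _ _ _ a' b') E'.
have [m [c [d [Ec Ed]]]] := germ_eq_common E E'.
by exists m, c, d => x; have /= -> := Ec x; have /= -> := Ed x.
Qed.

Lemma pro_add_subproof X Y (f g : hom X Y) j j' (c : shom j j') :
  let p i := lower_bound (ph_idx f i) (ph_idx g i) in
  germ_eq (dmor Y c \oc germ_add (tagged (p j)).1 (tagged (p j)).2 (f j) (g j))
    (germ_add (tagged (p j')).1 (tagged (p j')).2 (f j') (g j')).
Proof.
move=> p; have := germ_eq_add (tagged (p j)).1 (tagged (p j)).2
  (tagged (p j')).1 (tagged (p j')).2 (ph_compat f c) (ph_compat g c).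
apply: germ_eq_trans; apply: germ_eq_heq => x /=.
exact: raddfD.
Qed.

Definition pro_add X Y (f g : hom X Y) : hom X Y :=
  let p i := lower_bound (ph_idx f i) (ph_idx g i) in
  @ProHom Ab X Y (fun j => tag (p j))
    (fun j => germ_add (tagged (p j)).1 (tagged (p j)).2 (f j) (g j))
    (pro_add_subproof f g).

Lemma pro_idx_inhabited X : exists i : pro_idx X, True.
Proof. by have [[i] _ _] := pro_idxP X; exists i. Qed.

Lemma pro_zero_subproof X Y (i0 : pro_idx X) j j' (c : shom j j') :
  germ_eq (dmor Y c \oc [the {additive X i0 -> Y j} of \0])
    [the {additive X i0 -> Y j'} of \0].
Proof. by apply: germ_eq_heq => x /=; exact: raddf0. Qed.

Definition pro_zero X Y : hom X Y :=
  let i0 := projT1 (cid (pro_idx_inhabited X)) in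
  @ProHom Ab X Y (fun=> i0) (fun j => [the {additive X i0 -> Y j} of \0])
    (@pro_zero_subproof X Y i0).

End ProZAdditive.

Definition is_kernel (K A B : ProZ) (f : hom A B) (k : hom K A) :=
  f \oc k =c pro_zero K B /\
  forall (N : ProZ) (g : hom N A), f \oc g =c pro_zero N B ->
    exists2 h : hom N K, k \oc h =c g &
      forall h' : hom N K, k \oc h' =c g -> h' =c h.

Definition is_cokernel (A B Q : ProZ) (f : hom A B) (q : hom B Q) :=
  q \oc f =c pro_zero A Q /\
  forall (N : ProZ) (g : hom B N), g \oc f =c pro_zero A N ->
    exists2 h : hom Q N, h \oc q =c g &
      forall h' : hom Q N, h' \oc q =c g -> h' =c h.

(* Objects of [ProZ] that are determined by a universal property only up to a
   unique isomorphism are represented by records [X] packing an object with the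
   morphisms that exhibit the property. *)

Record homology_at (A B C : ProZ) (f : hom A B) (g : hom B C) := HomologyAt {
  hcyc : ProZ;
  hcyc_in : hom hcyc B;
  hcycP : is_kernel g hcyc_in;
  hbdry : hom A hcyc;
  hbdryP : hcyc_in \oc hbdry =c f;
  hobj :> ProZ;
  hproj : hom hcyc hobj;
  hprojP : is_cokernel hbdry hproj }.

(* [h] is the morphism of homology objects induced by [b : B -> B']. *)
Definition homology_map (A B C A' B' C' : ProZ) (f : hom A B) (g : hom B C)
    (f' : hom A' B') (g' : hom B' C') (b : hom B B')
    (H : homology_at f g) (H' : homology_at f' g') (h : hom H H') :=
  exists2 z : hom (hcyc H) (hcyc H'),
    hcyc_in H' \oc z =c b \oc hcyc_in H & h \oc hproj H =c hproj H' \oc z.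

Definition pro_additive (P N : ProZ) (M : zmodType) (u : M -> hom P N) :=
  forall a b, u (a + b) =c pro_add (u a) (u b).

Record tensor (P : ProZ) (M : zmodType) := Tensor {
  tobj :> ProZ;
  tunit : M -> hom P tobj;
  tunitD : pro_additive tunit;
  tunitP : forall (N : ProZ) (v : M -> hom P N), pro_additive v ->
    exists2 w : hom tobj N, (forall a, w \oc tunit a =c v a) &
      forall w' : hom tobj N, (forall a, w' \oc tunit a =c v a) -> w' =c w }.

(* [w] is the adjoint of [v]. *)
Definition tensor_adjoint (P N : ProZ) (M : zmodType) (T : tensor P M)
    (v : M -> hom P N) (w : hom T N) :=
  forall a, w \oc tunit T a =c v a.

(* [t] is the morphism induced by [phi : P -> P'] and [g : M -> M']. *)
Definition tensor_map (P P' : ProZ) (M M' : zmodType) (phi : hom P P')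
    (g : {additive M -> M'}) (T : tensor P M) (T' : tensor P' M')
    (t : hom T T') :=
  tensor_adjoint (fun a => tunit T' (g a) \oc phi) t.

Definition projective (Q : Ab) :=
  forall (A B : Ab) (p : hom A B) (f : hom Q B), surjectivec p ->
    exists g : hom Q A, p \oc g =c f.

Record projective_resolution (G : zmodType) := ProjectiveResolution {
  rmod :> nat -> zmodType;
  rdiff : forall k, {additive rmod k.+1 -> rmod k};
  raug : {additive rmod 0%N -> G};
  rmod_proj : forall k, projective (rmod k);
  raug_surj : @surjectivec (rmod 0%N) G raug;
  raug_exact : forall x, raug x = 0 <-> exists y, x = rdiff 0%N y;
  rdiff_exact : forall k (x : rmod k.+1),
    rdiff k x = 0 <-> exists y, x = rdiff k.+1 y }.

Record tor1 (P : ProZ) (G : zmodType) := Tor1 {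
  tor_res : projective_resolution G;
  tor_tens : forall k, tensor P (tor_res k);
  tor_diff : forall k, hom (tor_tens k.+1) (tor_tens k);
  tor_diffP : forall k,
    tensor_map (idc P) (rdiff tor_res k) (tor_diff k);
  tor_obj :> homology_at (tor_diff 1%N) (tor_diff 0%N) }.

(* [t] is the morphism induced by [phi : P -> P'] and [g : G -> G'], through a
   lift [q] of [g] to the resolutions. *)
Definition tor1_map (P P' : ProZ) (G G' : zmodType) (phi : hom P P')
    (g : {additive G -> G'}) (T : tor1 P G) (T' : tor1 P' G') (t : hom T T') :=
  exists (q : forall k, {additive tor_res T k -> tor_res T' k})
         (w : forall k, hom (tor_tens T k) (tor_tens T' k)),
    [/\ forall x, raug (tor_res T') (q 0%N x) = g (raug (tor_res T) x),
        forall k x, rdiff (tor_res T') k (q k.+1 x) =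
                    q k (rdiff (tor_res T) k x),
        forall k, tensor_map phi (q k) (w k) &
        homology_map (w 1%N) t].

Definition TOP : category.
Proof.
refine (@Category topologicalType (fun X Y => continuousType X Y)
  (fun X Y f g => f =1 g) (fun X => [the continuousType X X of idfun])
  (fun X Y Z g f => [the continuousType X Z of g \o f]) _ _ _ _ _ _ _) => //.
- by move=> X Y f g E x; rewrite E.
- by move=> X Y f g h E E' x; rewrite E.
- by move=> X Y Z g g' f f' E E' x /=; rewrite E E'.
Defined.

Section Homotopy.
Variable R : realType.

Definition unit_interval : topologicalType := set_type `[0 : R, 1 : R].

Lemma i0_subproof : (0 : R) \in `[0 : R, 1 : R]%classic.
Proof. by apply: mem_set; rewrite /= in_itv /= lexx ler01. Qed.

Lemma i1_subproof : (1 : R) \in `[0 : R, 1 : R]%classic.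
Proof. by apply: mem_set; rewrite /= in_itv /= lexx ler01. Qed.

Definition i0 : unit_interval := exist _ 0 i0_subproof.
Definition i1 : unit_interval := exist _ 1 i1_subproof.

Definition cylinder (X : topologicalType) : topologicalType :=
  (X * unit_interval)%type.

Definition is_homotopy (X Y : topologicalType) (f g : X -> Y)
    (H : continuousType (cylinder X) Y) :=
  forall x, H (x, i0) = f x /\ H (x, i1) = g x.

Definition homotopic (X Y : topologicalType) (f g : X -> Y) :=
  exists H, is_homotopy f g H.

Definition homotopic_rel (X Y : topologicalType) (A : set X) (f g : X -> Y) :=
  exists2 H, is_homotopy f g H & forall x t, A x -> H (x, t) = f x.

Definition homotopy_equivalence (X Y : topologicalType)
    (f : continuousType X Y) :=
  exists g : continuousType Y X, homotopic (g \o f) id /\ homotopic (f \o g) id.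

End Homotopy.

Record simplicial_complex := SimplicialComplex {
  vertex : choiceType;
  face : set {fset vertex};
  face_neq0 : forall s, face s -> s != fset0;
  face1 : forall v, face [fset v]%fset;
  face_sub : forall s t, face s -> (t `<=` s)%fset -> t != fset0 -> face t }.

Section Realization.
Variables (R : realType) (K : simplicial_complex).

Definition supported (s : {fset vertex K}) (t : vertex K -> R) :=
  forall v, v \notin s -> t v = 0.

Definition barycentric (t : vertex K -> R) :=
  (forall v, 0 <= t v) /\
  exists s, [/\ face s, supported s t & \sum_(v <- s) t v = 1].

Definition realization := {t : vertex K -> R | barycentric t}.

(* The simplex [s] of the realization has the topology of a subspace of
   [R ^ vertex K], and [U] is open iff its trace on each simplex is open. *)
Definition weakly_open (U : set realization) :=
  forall s, face s -> exists2 O : set {ptws vertex K -> R}, open O &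
    forall x : realization, supported s (sval x) -> (U x <-> O (sval x)).

Lemma weakly_openT : weakly_open setT.
Proof. by move=> s _; exists setT => //; exact: openT. Qed.

Lemma weakly_openI : setI_closed weakly_open.
Proof.
move=> U V oU oV s Ks; have [W opW UO] := oU s Ks; have [P opP VP] := oV s Ks.
exists (W `&` P); first exact: openI.
by move=> x sx; split=> -[/(UO _ sx) ? /(VP _ sx)].
Qed.

Lemma weakly_open_bigU (I : Type) (f : I -> set realization) :
  (forall i, weakly_open (f i)) -> weakly_open (\bigcup_i f i).
Proof.
move=> opf s Ks.
pose good i (O : set {ptws vertex K -> R}) := open O /\
  forall x : realization, supported s (sval x) -> (f i x <-> O (sval x)).
exists (\bigcup_(p in [set p : I * set {ptws vertex K -> R} | good p.1 p.2]) p.2).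
  by apply: bigcup_open => -[i W] [].
move=> x sx; split=> [[i _ fix_]|[[i W] [/= _ iW] Wx]].
  have [W opW fO] := opf i s Ks; exists (i, W) => //.
  exact/fO.
by exists i => //; exact/iW.
Qed.

HB.instance Definition _ := gen_eqMixin realization.
HB.instance Definition _ := gen_choiceMixin realization.
HB.instance Definition _ := @isOpenTopological.Build realization
  weakly_open weakly_openT weakly_openI weakly_open_bigU.

End Realization.

Definition polyhedron (R : realType) (K : simplicial_complex) :
  topologicalType := realization R K.

Definition polyhedral_type (R : realType) (X : topologicalType) :=
  exists (K : simplicial_complex) (f : continuousType X (polyhedron R K)),
    homotopy_equivalence R f.

Definition POL (R : realType) : category :=
  @full_sub TOP (polyhedral_type R).

Section LinearExtension.
Variables (S : choiceType) (G A : zmodType) (phi : S -> {additive G -> A}).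

(* The homomorphism that sends the chain [g * s] to [phi s g]. *)
Definition lin_ext (c : malg S G) : A :=
  \sum_(s <- msupp c) phi s (mcoeff s c).

Lemma lin_extE (c : malg S G) (D : {fset S}) : (msupp c `<=` D)%fset ->
  lin_ext c = \sum_(s <- D) phi s (mcoeff s c).
Proof.
move=> cD; rewrite /lin_ext; apply: big_fset_incl => // s _ /mcoeff_outdom ->.
exact: raddf0.
Qed.

Lemma lin_ext_is_zmod_morphism : zmod_morphism lin_ext.
Proof.
move=> c d; pose D := (msupp c `|` msupp d)%fset.
rewrite (@lin_extE c D) ?fsubsetUl // (@lin_extE d D) ?fsubsetUr //.
rewrite (@lin_extE (c - d) D) ?msuppB_le // -sumrB.
by apply: eq_bigr => s _; rewrite mcoeffB raddfB.
Qed.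

HB.instance Definition _ :=
  GRing.isZmodMorphism.Build (malg S G) A lin_ext lin_ext_is_zmod_morphism.

Lemma lin_extU s g : lin_ext (mkmalgU s g) = phi s g.
Proof.
rewrite (@lin_extE _ [fset s]%fset) ?msuppU_le // big_seq_fset1 mcoeffU eqxx.
by rewrite mulr1n.
Qed.

End LinearExtension.

Lemma chain_ind (S : choiceType) (G : zmodType) (P : malg S G -> Prop) :
  P 0 -> (forall c d, P c -> P d -> P (c + d)) ->
  (forall s g, P (mkmalgU s g)) -> forall c, P c.
Proof. by move=> P0 PD PU c; rewrite (monalgE c); apply: big_ind. Qed.

Section SingularChains.
Variable R : realType.

Definition simplex_set (n : nat) : set {ptws 'I_n.+1 -> R} :=
  [set t | (forall i, 0 <= t i) /\ \sum_i t i = 1].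
Arguments simplex_set : clear implicits.

Definition std_simplex (n : nat) : topologicalType := set_type (simplex_set n).

(* The [i]-th face inclusion inserts a zero barycentric coordinate at [i]. *)
Definition face_coord n (i : 'I_n.+2) (t : 'I_n.+1 -> R) (j : 'I_n.+2) : R :=
  if unlift i j is Some k then t k else 0.

Lemma face_coord_subproof n (i : 'I_n.+2) (t : std_simplex n) :
  (face_coord i (sval t) : {ptws 'I_n.+2 -> R}) \in simplex_set n.+1.
Proof.
case: t => t /= /set_mem[/= t0 t1]; apply: mem_set; split=> /=.
  by move=> j; rewrite /face_coord; case: unlift.
rewrite (bigD1_ord i) //= /face_coord unlift_none add0r -t1.
by apply: eq_bigr => k _; rewrite liftK.
Qed.

Definition face_fun n (i : 'I_n.+2) (t : std_simplex n) : std_simplex n.+1 :=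
  exist (fun u => u \in simplex_set n.+1) _ (face_coord_subproof i t).

Lemma face_fun_continuous n (i : 'I_n.+2) : continuous (@face_fun n i).
Proof.
apply: continuous_comp_initial => t.
have Ff : Filter (fmap (set_val \o face_fun i) (nbhs t)).
  exact: fmap_filter (nbhs_filter t).
apply/cvg_sup => j.
apply/cvg_image; first by rewrite eqEsubset; split=> v // _; exists (cst v).
move=> W /= Wt; exists ((fun u : 'I_n.+2 -> R => u j) @^-1` W); last first.
  by rewrite eqEsubset; split => [j' [? + <-//]|j' Wj]; exists (cst j').
rewrite /= /nbhs /=; suff : continuous (fun u : std_simplex n => face_coord i (sval u) j).
  by move=> /(_ t W); exact.
rewrite /face_coord; case: unlift => [k|]; last exact: cst_continuous.
move=> u; have cv : continuous (set_val : std_simplex n -> {ptws 'I_n.+1 -> R}).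
  exact: initial_continuous.
apply: (continuous_comp (cv u) (@proj_continuous 'I_n.+1 (fun=> R) k _)).
Qed.

Definition face_incl n (i : 'I_n.+2) :
    continuousType (std_simplex n) (std_simplex n.+1) :=
  [the continuousType _ _ of mkcts (@face_fun_continuous n i)].

Definition sing (n : nat) (X : topologicalType) : choiceType :=
  continuousType (std_simplex n) X.

Definition sing_face n (X : topologicalType) (i : 'I_n.+2) (s : sing n.+1 X) :
    sing n X :=
  [the continuousType (std_simplex n) X of s \o face_incl i].

Definition sing_map n (X Y : topologicalType) (f : continuousType X Y)
    (s : sing n X) : sing n Y :=
  [the continuousType (std_simplex n) Y of f \o s].

Definition chain (n : nat) (X : topologicalType) (G : zmodType) : zmodType :=
  malg (sing n X) G.

Definition bdry_gen n (X : topologicalType) (G : zmodType) (s : sing n.+1 X) (g : G) :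
    chain n X G :=
  \sum_(i < n.+2) mkmalgU (sing_face i s) (g *~ (-1) ^+ i).

Lemma bdry_gen_is_zmod_morphism n X G s : zmod_morphism (@bdry_gen n X G s).
Proof.
move=> g h; rewrite /bdry_gen -sumrB; apply: eq_bigr => i _.
by rewrite mulrzBl raddfB.
Qed.

HB.instance Definition _ n X G s := GRing.isZmodMorphism.Build G (chain n X G)
  (@bdry_gen n X G s) (@bdry_gen_is_zmod_morphism n X G s).

Definition bdry n (X : topologicalType) (G : zmodType) :
    {additive chain n.+1 X G -> chain n X G} :=
  [the {additive _ -> _} of lin_ext (fun s =>
     [the {additive G -> chain n X G} of bdry_gen s])].

Definition chain_map n (X Y : topologicalType) (G G' : zmodType)
    (f : continuousType X Y) (g : {additive G -> G'}) :
    {additive chain n X G -> chain n Y G'} :=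
  [the {additive _ -> _} of lin_ext (fun s =>
     [the {additive G -> chain n Y G'} of
        (fun h => mkmalgU (sing_map f s) h) \o g])].

Lemma bdryU n X (G : zmodType) (s : sing n.+1 X) (g : G) :
  bdry n X G (mkmalgU s g) = bdry_gen s g.
Proof. exact: lin_extU. Qed.

Lemma chain_mapU n (X Y : topologicalType) (G G' : zmodType)
    (f : continuousType X Y) (g : {additive G -> G'}) (s : sing n X) (h : G) :
  chain_map n f g (mkmalgU s h) = mkmalgU (sing_map f s) (g h).
Proof. exact: lin_extU. Qed.

Lemma chain_map_bdry n (X Y : topologicalType) (G G' : zmodType)
    (f : continuousType X Y) (g : {additive G -> G'}) c :
  chain_map n f g (bdry n X G c) = bdry n Y G' (chain_map n.+1 f g c).
Proof.
elim/chain_ind: c => [|c d Ec Ed|s h]; first by rewrite !raddf0.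
  by rewrite !raddfD Ec Ed.
rewrite bdryU chain_mapU bdryU raddf_sum; apply: eq_bigr => i _.
rewrite chain_mapU raddfMz; congr mkmalgU; exact/continuousEP.
Qed.

Lemma chain_map1 n (X : topologicalType) (G : zmodType) (c : chain n X G) :
  chain_map n [the continuousType X X of idfun] [the {additive G -> G} of idfun] c = c.
Proof.
elim/chain_ind: c => [|c d Ec Ed|s h]; first by rewrite raddf0.
  by rewrite raddfD Ec Ed.
by rewrite chain_mapU /=; congr mkmalgU; exact/continuousEP.
Qed.

Lemma chain_map_comp n (X Y Z : topologicalType) (G G' G'' : zmodType)
    (f' : continuousType Y Z) (f : continuousType X Y)
    (g' : {additive G' -> G''}) (g : {additive G -> G'})
    c :
  chain_map n f' g' (chain_map n f g c) =
  chain_map n [the continuousType X Z of f' \o f]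
    [the {additive G -> G''} of g' \o g] c.
Proof.
elim/chain_ind: c => [|c d Ec Ed|s h]; first by rewrite !raddf0.
  by rewrite !raddfD Ec Ed.
by rewrite !chain_mapU /=; congr mkmalgU; exact/continuousEP.
Qed.

Lemma chain_map_ext n (X Y : topologicalType) (G G' : zmodType)
    (f f' : continuousType X Y)
    (g g' : {additive G -> G'}) c : f =1 f' -> g =1 g' ->
  chain_map n f g c = chain_map n f' g' c.
Proof.
move=> Ef Eg; elim/chain_ind: c => [|c d Ec Ed|s h]; first by rewrite !raddf0.
  by rewrite !raddfD Ec Ed.
rewrite !chain_mapU Eg; congr mkmalgU; apply/continuousEP => t /=.
exact: Ef.
Qed.

Definition is_cycle n (X : topologicalType) (G : zmodType) :
    {pred chain n X G} :=
  match n return {pred chain n X G} with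
  | 0%N => predT
  | m.+1 => fun c => bdry m X G c == 0
  end.

Lemma is_cycle_zmod_closed n X G : zmod_closed (@is_cycle n X G).
Proof.
case: n => [|n]; first by split.
split=> [|c d]; rewrite !unfold_in ?raddf0 //.
by move=> /eqP Ec /eqP Ed; rewrite raddfB Ec Ed subrr.
Qed.

HB.instance Definition _ n X G :=
  GRing.isZmodClosed.Build (chain n X G) (@is_cycle n X G)
    (@is_cycle_zmod_closed n X G).

Definition cycles n (X : topologicalType) (G : zmodType) :=
  {c : chain n X G | c \in @is_cycle n X G}.

HB.instance Definition _ n X G := SubChoice.on (cycles n X G).
HB.instance Definition _ n X G :=
  [SubChoice_isSubZmodule of cycles n X G by <:].

(* The boundaries, as a subgroup of the group of cycles. *)
Definition is_boundary n (X : topologicalType) (G : zmodType) :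
    {pred cycles n X G} :=
  fun z => `[< exists b, val z = bdry n X G b >].

Lemma is_boundary_zmod_closed n X G : zmod_closed (@is_boundary n X G).
Proof.
split=> [|c d]; rewrite !unfold_in; first by apply/asboolP; exists 0; rewrite !raddf0.
move=> /asboolP[b Eb] /asboolP[b' Eb']; apply/asboolP; exists (b - b').
by rewrite !raddfB /= Eb Eb'.
Qed.

HB.instance Definition _ n X G :=
  GRing.isZmodClosed.Build (cycles n X G) (@is_boundary n X G)
    (@is_boundary_zmod_closed n X G).

Definition homology n (X : topologicalType) (G : zmodType) : zmodType :=
  Quotient.quot (@is_boundary n X G : zmodClosed (cycles n X G)).

Definition hclass n X G (z : cycles n X G) : homology n X G :=
  \pi_(Quotient.quot (@is_boundary n X G : zmodClosed (cycles n X G))) z.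

Lemma hclassB n X G : zmod_morphism (@hclass n X G).
Proof. by move=> x y; rewrite /hclass raddfB. Qed.

Lemma hclass_eq n X G (z z' : cycles n X G) :
  hclass z = hclass z' <-> exists b, val z - val z' = bdry n X G b.
Proof.
rewrite /hclass; split=> [/eqP|H].
  by rewrite -Quotient.idealrBE unfold_in => /asboolP.
by apply/eqP; rewrite -Quotient.idealrBE unfold_in; apply/asboolP.
Qed.

Lemma cycle_map_subproof n (X Y : topologicalType) (G G' : zmodType)
    (f : continuousType X Y) (g : {additive G -> G'}) (z : cycles n X G) :
  chain_map n f g (val z) \in @is_cycle n Y G'.
Proof.
case: n z => [//|n] [z /= Ez].
have {}Ez : bdry n X G z = 0 by apply/eqP.
by apply/eqP; rewrite -chain_map_bdry Ez raddf0.
Qed.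

Definition cycle_map n (X Y : topologicalType) (G G' : zmodType)
    (f : continuousType X Y) (g : {additive G -> G'}) (z : cycles n X G) :
    cycles n Y G' :=
  exist (fun c => c \in @is_cycle n Y G') _ (cycle_map_subproof f g z).

Definition homology_fun n (X Y : topologicalType) (G G' : zmodType)
    (f : continuousType X Y) (g : {additive G -> G'}) (h : homology n X G) :
    homology n Y G' :=
  hclass (cycle_map f g (repr h)).

Lemma homology_funE n (X Y : topologicalType) (G G' : zmodType)
    (f : continuousType X Y) (g : {additive G -> G'}) (z : cycles n X G) :
  homology_fun f g (hclass z) = hclass (cycle_map f g z).
Proof.
have /hclass_eq[b Eb] : hclass (repr (hclass z)) = hclass z by exact: reprK.
apply/hclass_eq; exists (chain_map n.+1 f g b).
by rewrite -chain_map_bdry -Eb /= raddfB.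
Qed.

Lemma hclass_surj n X G (h : homology n X G) : exists z, h = hclass z.
Proof. by exists (repr h); rewrite /hclass reprK. Qed.

Lemma homology_fun_is_zmod_morphism n (X Y : topologicalType) (G G' : zmodType)
    (f : continuousType X Y) (g : {additive G -> G'}) :
  zmod_morphism (@homology_fun n X Y G G' f g).
Proof.
move=> h h'; have [z ->] := hclass_surj h; have [z' ->] := hclass_surj h'.
rewrite -hclassB !homology_funE -hclassB; congr hclass.
by apply: val_inj; rewrite raddfB /= !raddfB.
Qed.

HB.instance Definition _ n (X Y : topologicalType) (G G' : zmodType) f g :=
  GRing.isZmodMorphism.Build (homology n X G) (homology n Y G')
    (@homology_fun n X Y G G' f g)
    (@homology_fun_is_zmod_morphism n X Y G G' f g).

Lemma homology_fun1 n (X : topologicalType) (G : zmodType) (h : homology n X G) :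
  homology_fun [the continuousType X X of idfun]
    [the {additive G -> G} of idfun] h = h.
Proof.
have [z ->] := hclass_surj h; rewrite homology_funE; congr hclass.
by apply: val_inj; rewrite /= chain_map1.
Qed.

Lemma homology_fun_comp n (X Y Z : topologicalType) (G G' G'' : zmodType)
    (f' : continuousType Y Z) (f : continuousType X Y)
    (g' : {additive G' -> G''}) (g : {additive G -> G'}) (h : homology n X G) :
  homology_fun f' g' (homology_fun f g h) =
  homology_fun [the continuousType X Z of f' \o f]
    [the {additive G -> G''} of g' \o g] h.
Proof.
have [z ->] := hclass_surj h; rewrite !homology_funE; congr hclass.
by apply: val_inj; rewrite /= chain_map_comp.
Qed.

Lemma homology_fun_ext n (X Y : topologicalType) (G G' : zmodType)
    (f f' : continuousType X Y) (g g' : {additive G -> G'})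
    (h : homology n X G) : f =1 f' -> g =1 g' ->
  homology_fun f g h = homology_fun f' g' h.
Proof.
move=> Ef Eg; have [z ->] := hclass_surj h; rewrite !homology_funE.
by congr hclass; apply: val_inj; exact: chain_map_ext.
Qed.

End SingularChains.

Section ProHomology.
Variable R : realType.

Definition homology_functor_nat (n : nat) (G : zmodType) : functor TOP Ab.
Proof.
refine (@Functor TOP Ab (fun X => homology R n X G)
  (fun X Y f => [the {additive homology R n X G -> homology R n Y G} of
     homology_fun f [the {additive G -> G} of idfun]]) _ _ _).
- by move=> X Y f g E h; exact: homology_fun_ext.
- by move=> X h; exact: homology_fun1.
- move=> X Y Z g f h; rewrite /= homology_fun_comp; exact: homology_fun_ext.
Defined.

Definition homology_coef_nat (n : nat) (G G' : zmodType)
    (g : {additive G -> G'}) :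
  nat_trans (homology_functor_nat n G) (homology_functor_nat n G').
Proof.
refine (@NatTrans TOP Ab (homology_functor_nat n G)
  (homology_functor_nat n G') (fun X =>
  [the {additive homology R n X G -> homology R n X G'} of
     homology_fun [the continuousType X X of idfun] g]) _).
by move=> X Y f h /=; rewrite !homology_fun_comp; exact: homology_fun_ext.
Defined.

Definition zero_group : Ab := ('rV[int]_0 : zmodType).

Definition zero_functor : functor TOP Ab.
Proof.
by refine (@Functor TOP Ab (fun=> zero_group) (fun _ _ _ => idc zero_group) _ _ _).
Defined.

Definition homology_functor (n : int) (G : zmodType) : functor TOP Ab :=
  match n with
  | Posz k => homology_functor_nat k G
  | Negz _ => zero_functor
  end.

Definition homology_coef (n : int) (G G' : zmodType) (g : {additive G -> G'}) :
    nat_trans (homology_functor n G) (homology_functor n G') :=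
  match n with
  | Posz k => homology_coef_nat k g
  | Negz _ => @NatTrans TOP Ab zero_functor zero_functor
                (fun=> idc zero_group) (fun _ _ _ _ => erefl)
  end.

Definition pro_homology (n : int) (G : zmodType) : functor (Pro (POL R)) ProZ :=
  pro_functor (@full_restr TOP (polyhedral_type R) _ (homology_functor n G)).

Definition pro_homology_coef (n : int) (G G' : zmodType) (g : {additive G -> G'})
    (X : Pro (POL R)) : hom (pro_homology n G X) (pro_homology n G' X) :=
  pro_trans (@full_restr_nat TOP (polyhedral_type R) _ _ _
    (homology_coef n g)) X.

Definition times_fun (G : zmodType) (a : G) (m : int) : G := a *~ m.

Lemma times_fun_is_zmod_morphism G a : zmod_morphism (@times_fun G a).
Proof. by move=> m m'; exact: mulrzBr. Qed.

HB.instance Definition _ G a := GRing.isZmodMorphism.Build int G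
  (@times_fun G a) (@times_fun_is_zmod_morphism G a).

(* [a |-> \bar a_*], induced by the chain maps [c |-> c (x) a]. *)
Definition bar (n : int) (G : zmodType) (X : Pro (POL R)) (a : G) :
    hom (pro_homology n int X) (pro_homology n G X) :=
  pro_homology_coef n [the {additive int -> G} of times_fun a] X.

End ProHomology.

(* A morphism of the category of fractions [C[W^-1]] is represented by a zigzag
   of morphisms of [C] whose backward steps lie in [W]. *)

Section Fractions.
Variables (C : category) (W : forall A B : C, hom A B -> Prop).

Inductive zigzag : C -> C -> Type :=
| zz_nil A : zigzag A A
| zz_fwd A B Z : hom A B -> zigzag B Z -> zigzag A Z
| zz_bwd A B Z (s : hom B A) : W s -> zigzag B Z -> zigzag A Z.

Fixpoint zz_cat A B Z (z : zigzag A B) : zigzag B Z -> zigzag A Z :=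
  match z with
  | zz_nil A => fun y => y
  | zz_fwd A A' B f z => fun y => zz_fwd f (zz_cat z y)
  | zz_bwd A A' B s Ws z => fun y => zz_bwd Ws (zz_cat z y)
  end.

Inductive zz_eq : forall A B, zigzag A B -> zigzag A B -> Prop :=
| zz_refl A B (z : zigzag A B) : zz_eq z z
| zz_sym A B (z y : zigzag A B) : zz_eq z y -> zz_eq y z
| zz_trans A B (z y x : zigzag A B) : zz_eq z y -> zz_eq y x -> zz_eq z x
| zz_fwd_eq A B Z (f g : hom A B) (z y : zigzag B Z) :
    f =c g -> zz_eq z y -> zz_eq (zz_fwd f z) (zz_fwd g y)
| zz_bwd_eq A B Z (s : hom B A) (Ws Ws' : W s) (z y : zigzag B Z) :
    zz_eq z y -> zz_eq (zz_bwd Ws z) (zz_bwd Ws' y)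
| zz_fwd1 A B (z : zigzag A B) : zz_eq (zz_fwd (idc A) z) z
| zz_fwd_comp A B Z T (g : hom B Z) (f : hom A B) (z : zigzag Z T) :
    zz_eq (zz_fwd f (zz_fwd g z)) (zz_fwd (g \oc f) z)
| zz_fwd_bwd A B Z (s : hom A B) (Ws : W s) (z : zigzag A Z) :
    zz_eq (zz_fwd s (zz_bwd Ws z)) z
| zz_bwd_fwd A B Z (s : hom B A) (Ws : W s) (z : zigzag A Z) :
    zz_eq (zz_bwd Ws (zz_fwd s z)) z.

Lemma zz_cats0 A B (z : zigzag A B) : zz_cat z (zz_nil B) = z.
Proof. by elim: z => [|? ? ? f z /= ->|? ? ? s Ws z /= ->]. Qed.

Lemma zz_catA A B Z T (z : zigzag A B) (y : zigzag B Z) (x : zigzag Z T) :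
  zz_cat z (zz_cat y x) = zz_cat (zz_cat z y) x.
Proof. by elim: z y => [|? ? ? f z IH|? ? ? s Ws z IH] y //=; rewrite IH. Qed.

Lemma zz_cat_eq A B Z (z z' : zigzag A B) (y y' : zigzag B Z) :
  zz_eq z z' -> zz_eq y y' -> zz_eq (zz_cat z y) (zz_cat z' y').
Proof.
move=> Ez Ey; apply: (@zz_trans _ _ _ (zz_cat z y')).
  elim: z y y' Ey {Ez} => [|? ? ? f z IH|? ? ? s Ws z IH] //= y y' Ey.
    exact: zz_fwd_eq (heq_refl _) (IH _ _ Ey).
  exact: zz_bwd_eq (IH _ _ Ey).
elim: Ez y' {y Ey} => /=.
- by move=> A0 B0 x y'; exact: zz_refl.
- by move=> A0 B0 x u _ IH y'; exact: zz_sym (IH y').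
- by move=> A0 B0 x u v _ IH _ IH' y'; exact: zz_trans (IH y') (IH' y').
- by move=> A0 B0 Z0 f g x u Efg _ IH y'; exact: zz_fwd_eq Efg (IH y').
- by move=> A0 B0 Z0 s Ws Ws' x u _ IH y'; exact: zz_bwd_eq (IH y').
- by move=> A0 B0 x y'; exact: zz_fwd1.
- by move=> A0 B0 Z0 T0 g f x y'; exact: zz_fwd_comp.
- by move=> A0 B0 Z0 s Ws x y'; exact: zz_fwd_bwd.
- by move=> A0 B0 Z0 s Ws x y'; exact: zz_bwd_fwd.
Qed.

Definition fractions : category := {|
  obj := C; hom := zigzag; heq := zz_eq;
  idc := zz_nil;
  ccomp := fun A B Z z y => zz_cat y z;
  heq_refl := zz_refl; heq_sym := zz_sym; heq_trans := zz_trans;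
  ccomp_heq := fun A B Z z z' y y' Ez Ey => zz_cat_eq Ey Ez;
  compcA := fun A B Z T z y x =>
    eq_ind _ (fun u => zz_eq u (zz_cat x (zz_cat y z)))
      (zz_refl _) _ (zz_catA x y z);
  compc1 := fun A B z => zz_refl z;
  comp1c := fun A B z =>
    eq_ind_r (fun u => zz_eq u z) (zz_refl z) (zz_cats0 z) |}.

Variables (D : category) (F : functor C D).

(* Let [F] send the morphisms in [W] to isomorphisms. Then [fractions_map F z h]
   holds iff [h] is the image of [z] under the extension of [F] to [fractions]. *)
Fixpoint fractions_map A B (z : zigzag A B) :
    hom (F A) (F B) -> Prop :=
  match z in zigzag A B return hom (F A) (F B) -> Prop with
  | zz_nil A => fun h => h =c idc (F A)
  | zz_fwd A A' B f z => fun h =>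
      exists2 k, fractions_map z k & h =c k \oc fmor F f
  | zz_bwd A A' B s _ z => fun h =>
      exists k t, [/\ fractions_map z k, inverse_of (fmor F s) t &
        h =c k \oc t]
  end.

End Fractions.

Arguments fractions_map {C W D} F {A B} z h.

Section StrongShape.
Variable R : realType.

(* [f] is given by a cofinal functor [phi] and a natural transformation [psi]
   from [X \o phi] to [Y] which consists of homotopy equivalences. *)
Definition special (X Y : Pro (POL R)) (f : hom X Y) :=
  exists (phi : small_functor (pro_idx Y) (pro_idx X))
         (psi : forall j, hom (X (phi j)) (Y j)),
    [/\ cofinal phi,
        forall j j' (c : shom j j'),
          dmor Y c \oc psi j =c psi j' \oc dmor X (sfmor phi c),
        forall j, homotopy_equivalence R (psi j) &
        forall j, germ_eq (psi j) (f j)].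

(* A morphism in [Pro TOP] to [XX] from [X], seen as a constant system. *)
Record projection (X : topologicalType) (XX : Pro (POL R)) := Projection {
  pr :> forall i, continuousType X (sval (XX i));
  prP : forall i j (a : shom i j) x, dmor XX a (pr i x) = pr j x }.

Definition cyl_map (X Y : topologicalType) (f : X -> Y)
    (xt : cylinder R X) : cylinder R Y := (f xt.1, xt.2).

Definition strong_expansion_S1 X (XX : Pro (POL R)) (p : projection X XX) :=
  forall (K : simplicial_complex) (f : continuousType X (polyhedron R K)),
    exists i (h : continuousType (sval (XX i)) (polyhedron R K)),
      homotopic R f (h \o p i).

Definition strong_expansion_S2 X (XX : Pro (POL R)) (p : projection X XX) :=
  forall (K : simplicial_complex) i
    (h0 h1 : continuousType (sval (XX i)) (polyhedron R K))
    (F : continuousType (cylinder R X) (polyhedron R K)),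
    is_homotopy (h0 \o p i) (h1 \o p i) F ->
    exists i' (a : shom i' i)
      (H : continuousType (cylinder R (sval (XX i'))) (polyhedron R K)),
      is_homotopy (h0 \o dmor XX a) (h1 \o dmor XX a) H /\
      homotopic_rel R [set xt : cylinder R X | xt.2 = i0 R \/ xt.2 = i1 R]
        (H \o cyl_map (p i')) F.

Definition strong_expansion X (XX : Pro (POL R)) (p : projection X XX) :=
  strong_expansion_S1 p /\ strong_expansion_S2 p.

(* An object of the strong shape category is a space together with one of its
   strong polyhedral expansions; two expansions of the same space give
   isomorphic objects. *)
Record ssh_obj := SShObj {
  ssh_space :> topologicalType;
  ssh_sys : Pro (POL R);
  ssh_proj : projection ssh_space ssh_sys;
  ssh_projP : strong_expansion ssh_proj }.

Definition SSh : category := {|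
  obj := ssh_obj;
  hom := fun X Y => @hom (fractions special) (ssh_sys X) (ssh_sys Y);
  heq := fun X Y => @heq (fractions special) _ _;
  idc := fun X => @idc (fractions special) (ssh_sys X);
  ccomp := fun X Y Z => @ccomp (fractions special) _ _ _;
  heq_refl := fun X Y => @heq_refl (fractions special) _ _;
  heq_sym := fun X Y => @heq_sym (fractions special) _ _;
  heq_trans := fun X Y => @heq_trans (fractions special) _ _;
  ccomp_heq := fun X Y Z => @ccomp_heq (fractions special) _ _ _;
  compcA := fun X Y Z T => @compcA (fractions special) _ _ _ _;
  compc1 := fun X Y => @compc1 (fractions special) _ _;
  comp1c := fun X Y => @comp1c (fractions special) _ _ |}.

Definition proH (n : int) (X : SSh) (G : zmodType) : ProZ :=
  pro_homology R n G (ssh_sys X).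

(* [h] is the morphism induced by [f : X -> Y] in [SSh]. *)
Definition proH_map (n : int) (G : zmodType) (X Y : SSh) (f : hom X Y)
    (h : hom (proH n X G) (proH n Y G)) :=
  fractions_map (pro_homology R n G) f h.

Definition proH_coef (n : int) (X : SSh) (G G' : zmodType)
    (g : {additive G -> G'}) : hom (proH n X G) (proH n X G') :=
  pro_homology_coef n g (ssh_sys X).

Definition pairing (n : int) (X : SSh) (G : zmodType)
    (T : tensor (proH n X int) G) (w : hom T (proH n X G)) :=
  tensor_adjoint (@bar R n G (ssh_sys X)) w.

Record pairing_coker (n : int) (X : SSh) (G : zmodType) := PairingCoker {
  pc_tens : tensor (proH n X int) G;
  pc_pair : hom pc_tens (proH n X G);
  pc_pairP : pairing pc_pair;
  pc_obj :> ProZ;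
  pc_proj : hom (proH n X G) pc_obj;
  pc_projP : is_cokernel pc_pair pc_proj }.

(* [m] is the morphism induced by [f] and [g]. *)
Definition pairing_coker_map (n : int) (X X' : SSh) (G G' : zmodType)
    (f : hom X X') (g : {additive G -> G'}) (Q : pairing_coker n X G)
    (Q' : pairing_coker n X' G') (m : hom Q Q') :=
  exists2 h : hom (proH n X G) (proH n X' G), proH_map f h &
    m \oc pc_proj Q =c pc_proj Q' \oc (proH_coef n X' g \oc h).

(* [t] is the morphism induced by [f] and [g]. *)
Definition proH_tor1_map (n : int) (X X' : SSh) (G G' : zmodType)
    (f : hom X X') (g : {additive G -> G'}) (T : tor1 (proH n X int) G)
    (T' : tor1 (proH n X' int) G') (t : hom T T') :=
  exists2 h : hom (proH n X int) (proH n X' int), proH_map f h & tor1_map h g t.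

Definition UCF_mono (CC : zmodType -> Prop) (n : int) :=
  forall (X : SSh) (G : zmodType), CC G ->
  forall (T : tensor (proH n X int) G) (w : hom T (proH n X G)),
    pairing w -> is_mono w.

Definition UCF_coker (CC : zmodType -> Prop) (n : int) :=
  exists theta : forall (X : SSh) (G : zmodType) (Q : pairing_coker n X G)
                   (T : tor1 (proH (n - 1) X int) G), @hom ProZ Q T,
    (forall X G, CC G -> forall Q T, is_iso (theta X G Q T)) /\
    (forall X X' G G', CC G -> CC G' ->
     forall (f : hom X X') (g : {additive G -> G'})
       (Q : pairing_coker n X G) (Q' : pairing_coker n X' G')
       (T : tor1 (proH (n - 1) X int) G) (T' : tor1 (proH (n - 1) X' int) G')
       (m : @hom ProZ Q Q') (t : @hom ProZ T T'),
       pairing_coker_map f g m -> proH_tor1_map f g t ->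
       theta X' G' Q' T' \oc m =c t \oc theta X G Q T).

Definition UCF (CC : zmodType -> Prop) :=
  forall n : int, UCF_mono CC n /\ UCF_coker CC n.

End StrongShape.

Definition AB (G : zmodType) := True.

(* Main.v *)
From HB Require Import structures.
From mathcomp Require Import all_boot all_order all_algebra finmap.
From mathcomp Require Import all_classical all_reals all_analysis.
From mathcomp Require Import -(notations) monalg.
Require Import Defs.

Set Implicit Arguments.
Unset Strict Implicit.
Unset Printing Implicit Defensive.

Import Order.TTheory GRing.Theory Num.Theory.
Import numFieldNormedType.Exports.

Local Open Scope classical_set_scope.
Local Open Scope ring_scope.

(** The pairing already fails to be a monomorphism in degree zero. Let [A] be an
uncountable set and let [X] be the Fortissimo space on [A]: one extra point
[None] is added to the discrete space [A], and its neighbourhoods are the sets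
with countable complement. A point of a polyhedron is determined by finitely
many of its barycentric coordinates, and a countable intersection of
neighbourhoods of [None] is again one. Hence every map from [X]
to a polyhedron is constant off a countable subset of [A]
([fort_polyhedron]), and a homotopy of such maps is the same path at all points
off a countable subset, because it suffices to control it at the rational times
([fort_homotopy]). Therefore the discrete spaces
[C + {None}], for [C] a countable subset of [A], form a strong polyhedral
expansion of [X] ([fort_strong_expansion]); here maps and homotopies factor
strictly, not only up to homotopy.

Write [P] for the zeroth pro-homology of [X] and let [G] be the free abelian
group on [A]. The tensor product of [P] and [G] is the direct sum in pro-groups
of copies of [P] indexed by [A]. It is indexed by all functions [phi] from [A]
to the index category of [P], the group of index [phi] being the direct sum of
the groups [P (phi a)] ([copower], [free_tensor]). On the summand of index [a]
the pairing is given by the generator [a] of [G].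

Let [Z] be the inverse system, over the countable subsets [C] of [A], of the free
abelian groups on the complements of [C]. The morphism from [Z] to the direct sum
that sends the generator [a] to the class of [a] minus the class of [None] in the
summand of index [a] is not zero: if [phi a] is the set consisting of [a], then
its component at [phi] vanishes on no generator of any [Z C], and [Z C] has
generators because [A] is uncountable ([tail_to_copower_neq0]). However, its
composite with the pairing is zero: at the level [C] the point [a] is identified
with [None] for every [a] outside [C] ([pairing_tail0]). *)

(** * Direct sums of abelian groups *)

Section DirectSum.
Variables (A : choiceType) (V : A -> zmodType).

Definition fin_supp (f : forall a, V a) :=
  exists D : {fset A}, forall a, a \notin D -> f a = 0.

(** The direct sum of a family of abelian groups: the finitely supported
    dependent functions. *)
Definition dsum := {f : forall a, V a | fin_supp f}.

Definition dcoord (f : dsum) : forall a, V a := sval f.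

Lemma dsum_eq (f g : dsum) : (forall a, dcoord f a = dcoord g a) -> f = g.
Proof.
case: f g => f Pf [g Pg] E; have Efg : f = g by exact: functional_extensionality_dep.
by case: g / Efg Pg {E} => Pg; rewrite (Prop_irrelevance Pf Pg).
Qed.

Lemma fin_supp0 : fin_supp (fun=> 0).
Proof. by exists fset0. Qed.

Lemma fin_suppD f g : fin_supp f -> fin_supp g ->
  fin_supp (fun a => f a + g a).
Proof.
move=> [D fD] [D' gD']; exists (D `|` D')%fset => a.
by rewrite in_fsetU negb_or => /andP[/fD -> /gD' ->]; rewrite addr0.
Qed.

Lemma fin_suppN f : fin_supp f -> fin_supp (fun a => - f a).
Proof. by move=> [D fD]; exists D => a /fD ->; rewrite oppr0. Qed.

Definition dsum0 : dsum := exist _ _ fin_supp0.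
Definition dsumD (f g : dsum) : dsum :=
  exist _ _ (fin_suppD (svalP f) (svalP g)).
Definition dsumN (f : dsum) : dsum := exist _ _ (fin_suppN (svalP f)).

Lemma dsumA : associative dsumD.
Proof. by move=> f g h; apply: dsum_eq => a; exact: addrA. Qed.

Lemma dsumC : commutative dsumD.
Proof. by move=> f g; apply: dsum_eq => a; exact: addrC. Qed.

Lemma dsum0D : left_id dsum0 dsumD.
Proof. by move=> f; apply: dsum_eq => a; exact: add0r. Qed.

Lemma dsumND : left_inverse dsum0 dsumN dsumD.
Proof. by move=> f; apply: dsum_eq => a; exact: addNr. Qed.

HB.instance Definition _ := gen_eqMixin dsum.
HB.instance Definition _ := gen_choiceMixin dsum.
HB.instance Definition _ :=
  GRing.isZmodule.Build dsum dsumA dsumC dsum0D dsumND.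

Lemma dcoordB a : zmod_morphism (fun f : dsum => dcoord f a).
Proof. by []. Qed.

Lemma dcoordD (f g : dsum) a : dcoord (f + g) a = dcoord f a + dcoord g a.
Proof. by []. Qed.

(** The inclusion of the summand of index [a]. *)
Definition dsum_in_fun a (x : V a) (b : A) : V b :=
  if pselect (a = b) is left E then ecast c (V c) E x else 0.

Lemma dsum_in_funE a (x : V a) : dsum_in_fun x a = x.
Proof.
rewrite /dsum_in_fun; case: pselect => // E.
by rewrite (Prop_irrelevance E erefl).
Qed.

Lemma dsum_in_fun0 a (x : V a) b : a <> b -> dsum_in_fun x b = 0.
Proof. by rewrite /dsum_in_fun; case: pselect. Qed.

Lemma dsum_in_supp a (x : V a) : fin_supp (dsum_in_fun x).
Proof.
exists [fset a]%fset => b; rewrite in_fset1 => /eqP ba.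
by apply: dsum_in_fun0 => ab; apply: ba.
Qed.

Definition dsum_in a (x : V a) : dsum := exist _ _ (dsum_in_supp x).

Lemma dsum_in_is_zmod_morphism a : zmod_morphism (@dsum_in a).
Proof.
move=> x y; apply: dsum_eq => b; rewrite /dcoord /=.
have [<-|ab] := pselect (a = b); first by rewrite !dsum_in_funE.
by rewrite !dsum_in_fun0 // subr0.
Qed.

HB.instance Definition _ a := GRing.isZmodMorphism.Build (V a) dsum (@dsum_in a)
  (@dsum_in_is_zmod_morphism a).

Lemma dsum_ind (P : dsum -> Prop) :
  P 0 -> (forall f g, P f -> P g -> P (f + g)) ->
  (forall a x, P (@dsum_in a x)) -> forall f, P f.
Proof.
move=> P0 PD PI f.
suff -> : f = \sum_(a <- projT1 (cid (svalP f))) dsum_in (dcoord f a).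
  by elim/big_ind: _.
case: cid => D fD /=; apply: dsum_eq => b.
have coord_sum (s : seq A) :
    dcoord (\sum_(a <- s) dsum_in (dcoord f a)) b =
    \sum_(a <- s) dsum_in_fun (dcoord f a) b.
  by elim: s => [|a s IH]; rewrite ?big_nil // !big_cons dcoordD IH.
rewrite coord_sum; have [bD|bD] := boolP (b \in D).
  rewrite (big_rem b) //= dsum_in_funE big1_seq ?addr0 // => a /andP[_ ].
  rewrite mem_rem_uniq ?fset_uniq // inE => /andP[/eqP ab _].
  exact: dsum_in_fun0.
rewrite [LHS](fD _ bD) big1_seq // => a /andP[_ aD]; apply: dsum_in_fun0 => ab.
by rewrite -ab aD in bD.
Qed.

Section Extension.
Variables (B : zmodType) (h : forall a, {additive V a -> B}).

(** The homomorphism on the direct sum with given restrictions to the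
    summands. *)
Definition dsum_ext (f : dsum) : B :=
  \sum_(a <- projT1 (cid (svalP f))) h a (dcoord f a).

Lemma dsum_extE (f : dsum) (D : {fset A}) :
  (forall a, a \notin D -> dcoord f a = 0) ->
  dsum_ext f = \sum_(a <- D) h a (dcoord f a).
Proof.
move=> fD; rewrite /dsum_ext; case: cid => D' fD' /=.
transitivity (\sum_(a <- (D `|` D')%fset) h a (dcoord f a)).
  by apply: big_fset_incl => [|a _ /fD' E]; rewrite ?fsubsetUr // /dcoord E raddf0.
by apply/esym/big_fset_incl => [|a _ /fD E]; rewrite ?fsubsetUl // E raddf0.
Qed.

Lemma dsum_ext_is_zmod_morphism : zmod_morphism dsum_ext.
Proof.
move=> f g; have [D fD] := svalP f; have [D' gD'] := svalP g.
have fU a : a \notin (D `|` D')%fset -> dcoord f a = 0.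
  by rewrite in_fsetU negb_or => /andP[/fD].
have gU a : a \notin (D `|` D')%fset -> dcoord g a = 0.
  by rewrite in_fsetU negb_or => /andP[_ /gD'].
rewrite (dsum_extE fU) (dsum_extE gU) (@dsum_extE _ (D `|` D')%fset).
  by rewrite -sumrB; apply: eq_bigr => a _; rewrite -raddfB.
by move=> a aU; rewrite [LHS]dcoordB fU ?gU ?subr0.
Qed.

HB.instance Definition _ := GRing.isZmodMorphism.Build dsum B dsum_ext
  dsum_ext_is_zmod_morphism.

Lemma dsum_ext_in a x : dsum_ext (@dsum_in a x) = h a x.
Proof.
rewrite (@dsum_extE _ [fset a]%fset); first by rewrite big_seq_fset1 /dcoord /= dsum_in_funE.
move=> b; rewrite in_fset1 => /eqP ba; rewrite /dcoord /= dsum_in_fun0 // => ab.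
exact: ba.
Qed.

End Extension.

Lemma additive_dsum_eq (B : zmodType) (u v : {additive dsum -> B}) :
  (forall a x, u (@dsum_in a x) = v (dsum_in x)) -> u =1 v.
Proof.
move=> E f; elim/dsum_ind: f => [|f g Ef Eg|//]; first by rewrite !raddf0.
by rewrite !raddfD Ef Eg.
Qed.

End DirectSum.

(** * The tensor product of a pro-group with a free abelian group *)

(** Between two objects of a thin category there is at most one arrow. *)
Definition thin (I : small_cat) := forall (i j : I) (a b : shom i j), a = b.

Section ThinGerms.
Variable P : ProZ.
Hypothesis thinP : thin (pro_idx P).

Lemma dmor_thin i j k (b : @shom (pro_idx P) j k) (a : shom i j) (c : shom i k)
    (x : P i) : dmor P b (dmor P a x) = dmor P c x.
Proof. by rewrite (thinP c (scomp b a)); have /= -> := dmor_comp P b a x. Qed.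

(** Equal germs agree at every sufficiently deep level, whichever bonding maps
    are used to get there. *)
Lemma germ_eq_down (B : Ab) i i' (f : hom (P i) B) (f' : hom (P i') B) :
  germ_eq f f' ->
  exists k, forall l (s : shom l k) (a : shom l i) (b : shom l i') x,
    f (dmor P a x) = f' (dmor P b x).
Proof.
move=> [k [c [d E]]]; exists k => l s a b x.
by rewrite -(dmor_thin c s) -(dmor_thin d s); exact: E.
Qed.

Lemma pro_add_eq (N : ProZ) (f f' g g' : hom P N) :
  f =c f' -> g =c g' -> pro_add f g =c pro_add f' g'.
Proof. by move=> Ef Eg j; exact: germ_eq_add. Qed.

(** Addition of morphisms of pro-groups is defined through chosen lower bounds
    and has group laws only up to [=c]; cancellation is the one needed. *)
Lemma pro_addI (N : ProZ) (f f' g g' : hom P N) :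
  pro_add f g =c pro_add f' g' -> g =c g' -> f =c f'.
Proof.
move=> Efg Eg j; have [k Ek] := germ_eq_down (Efg j).
have [k' Ek'] := germ_eq_down (Eg j).
set p := tag (lower_bound (ph_idx f j) (ph_idx g j)) in Ek *.
set p' := tag (lower_bound (ph_idx f' j) (ph_idx g' j)) in Ek *.
have [l [s s']] := lower_bound k k'; have [m [t t']] := lower_bound p p'.
have [n [u u']] := lower_bound l m.
have [a a'] := tagged (lower_bound (ph_idx f j) (ph_idx g j)).
have [b b'] := tagged (lower_bound (ph_idx f' j) (ph_idx g' j)).
exists n, (scomp a (scomp t u')), (scomp b (scomp t' u')) => x /=.
have := Ek n (scomp s u) (scomp t u') (scomp t' u') x.
rewrite /= !(dmor_thin _ _ (scomp a (scomp t u'))).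
rewrite (dmor_thin _ _ (scomp a' (scomp t u'))).
rewrite (dmor_thin _ _ (scomp b (scomp t' u'))).
rewrite (dmor_thin _ _ (scomp b' (scomp t' u'))).
by rewrite (Ek' n (scomp s' u) _ (scomp b' (scomp t' u'))) => /addIr.
Qed.

Lemma pro_add_idem (N : ProZ) (f : hom P N) :
  f =c pro_add f f -> f =c pro_zero P N.
Proof.
move=> Ef j; have [k Ek] := germ_eq_down (Ef j).
have [l [s t]] := lower_bound k (tag (lower_bound (ph_idx f j) (ph_idx f j))).
have [m [u u']] := lower_bound l (projT1 (cid (pro_idx_inhabited P))).
have [a a'] := tagged (lower_bound (ph_idx f j) (ph_idx f j)).
exists m, (scomp a (scomp t u)), u' => x /=.
have := Ek m (scomp s u) (scomp a (scomp t u)) (scomp t u) x.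
rewrite /= !(dmor_thin _ _ (scomp a (scomp t u))) => /esym/eqP.
by rewrite -subr_eq0 addrK => /eqP.
Qed.

Lemma pro_comp_add (T N : ProZ) (w : hom T N) (f g : hom P T) :
  w \oc pro_add f g =c pro_add (w \oc f) (w \oc g).
Proof. by move=> j; apply: germ_eq_heq => x /=; exact: raddfD. Qed.

End ThinGerms.

(** Two biadditive pairings with a free abelian group agree as soon as they
    agree on a basis. *)
Lemma pro_additive_eq (P N : ProZ) (A : choiceType) (u v : malg A int -> hom P N) :
  thin (pro_idx P) -> pro_additive u -> pro_additive v ->
  (forall a, u (mkmalgU a 1) =c v (mkmalgU a 1)) -> forall m, u m =c v m.
Proof.
move=> thinP uD vD E.
have SD m n : u m =c v m -> u n =c v n -> u (m + n) =c v (m + n).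
  move=> Em En; apply: heq_trans (uD _ _) _.
  exact: heq_trans (pro_add_eq Em En) (heq_sym (vD _ _)).
have SB m n : u (m + n) =c v (m + n) -> u n =c v n -> u m =c v m.
  move=> Emn; apply: (pro_addI thinP).
  apply: heq_trans (heq_sym (uD _ _)) _; exact: heq_trans Emn (vD _ _).
have S0 : u 0 =c v 0.
  have z0 w : @pro_additive P N (malg A int) w -> w 0 =c pro_zero P N.
    by move=> wD; apply: pro_add_idem => //; have := wD 0 0; rewrite addr0.
  exact: heq_trans (z0 _ uD) (heq_sym (z0 _ vD)).
elim/chain_ind => [//|//|a z].
have SU n : u (mkmalgU a n%:Z) =c v (mkmalgU a n%:Z).
  elim: n => [|n IH]; first by rewrite monalgU0.
  by rewrite intS monalgUD; exact: SD.
case: z => n //; apply: (SB _ (mkmalgU a n.+1%:Z)) => //.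
by rewrite NegzE -monalgUD addNr monalgU0.
Qed.

Section FreeTensor.
Variables (P : ProZ) (A : choiceType).
Hypothesis thinP : thin (pro_idx P).

(** The index category of the direct sum in pro-groups of copies of [P] indexed
    by [A]. *)
Definition copower_cat : small_cat.
Proof.
refine (@SmallCat (A -> pro_idx P) (fun phi psi => forall a, shom (phi a) (psi a))
  (fun phi a => sid (phi a)) (fun _ _ _ c b a => scomp (c a) (b a)) _ _ _).
- by move=> *; apply: functional_extensionality_dep => a; exact: scompA.
- by move=> *; apply: functional_extensionality_dep => a; exact: scomp1.
- by move=> *; apply: functional_extensionality_dep => a; exact: s1comp.
Defined.

Lemma copower_catP : cofiltrant copower_cat.
Proof.
split.
- by have [i _] := pro_idx_inhabited P; constructor; exact: (fun=> i).
- move=> phi psi; exists (fun a => tag (lower_bound (phi a) (psi a))).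
  by split; constructor=> a; case: (tagged (lower_bound (phi a) (psi a))).
- move=> phi psi c d; exists phi, (fun a => sid (phi a)).
  by apply: functional_extensionality_dep => a; exact: thinP.
Qed.

(** The group of index [phi] is the direct sum of the groups [P (phi a)]. *)
Definition copower_obj (phi : copower_cat) : zmodType :=
  dsum (fun a => P (phi a) : zmodType).

Lemma copower_mor_supp (phi psi : copower_cat) (c : shom phi psi)
    (f : copower_obj phi) :
  fin_supp (fun a => dmor P (c a) (dcoord f a) : (P (psi a) : zmodType)).
Proof.
by have [D fD] := svalP f; exists D => a /fD; rewrite /dcoord => ->; exact: raddf0.
Qed.

Definition copower_mor (phi psi : copower_cat) (c : shom phi psi)
    (f : copower_obj phi) : copower_obj psi :=
  exist _ _ (copower_mor_supp c f).

Lemma copower_mor_is_zmod_morphism (phi psi : copower_cat) (c : shom phi psi) :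
  zmod_morphism (@copower_mor phi psi c).
Proof. by move=> f g; apply: dsum_eq => a; exact: raddfB. Qed.

HB.instance Definition _ phi psi c :=
  GRing.isZmodMorphism.Build (copower_obj phi) (copower_obj psi)
    (@copower_mor phi psi c) (@copower_mor_is_zmod_morphism phi psi c).

Definition copower_diag : diagram copower_cat Ab.
Proof.
refine (@Diagram copower_cat Ab copower_obj (fun phi psi c =>
  [the {additive copower_obj phi -> copower_obj psi} of copower_mor c]) _ _).
- by move=> phi f; apply: dsum_eq => a; exact: (dmor1 P (phi a)).
- by move=> phi psi chi c d f; apply: dsum_eq => a; exact: (dmor_comp P (c a) (d a)).
Defined.

(** The direct sum in pro-groups of copies of [P] indexed by [A]. *)
Definition copower : ProZ := ProObj copower_catP copower_diag.

(** The bonding map from [P i] to [P j] if there is one, and zero otherwise. *)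
Definition bond i j : {additive (P i : zmodType) -> (P j : zmodType)} :=
  if pselect (exists s : shom i j, True) is left E then dmor P (projT1 (cid E))
  else [the {additive _ -> _} of \0].

Lemma bondE i j (s : shom i j) : bond i j =1 dmor P s.
Proof.
rewrite /bond; case: pselect => [E|[]]; last by exists s.
by rewrite (thinP (projT1 (cid E)) s).
Qed.

(** [i] lies below [phi a] for every [a] in the support of [m]. *)
Definition below (i : pro_idx P) (phi : copower_cat) (m : malg A int) :=
  forall a, a \in msupp m -> exists s : shom i (phi a), True.

Lemma below_ex phi m : exists i, below i phi m.
Proof.
suff [i iP] : exists i, forall a, a \in enum_fset (msupp m) ->
  exists s : shom i (phi a), True by exists i.
elim: (enum_fset (msupp m)) => [|a s [i iP]].
  by have [i _] := pro_idx_inhabited P; exists i.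
have [k [t t']] := lower_bound i (phi a); exists k => b.
rewrite inE => /predU1P[->|/iP[u _]]; first by exists t'.
by exists (scomp u t).
Qed.

Lemma pure_supp i (phi : copower_cat) (m : malg A int) (x : P i) :
  fin_supp (fun a => bond i (phi a) x *~ mcoeff a m).
Proof. by exists (msupp m) => a /mcoeff_outdom ->. Qed.

(** The tensor of [x] in [P i] with [m], as an element of the direct sum of the
    groups [P (phi a)]; it is meaningful when [i] lies below [phi] on the support
    of [m], and then natural in [i] and [phi]. *)
Definition pure i (phi : copower_cat) (m : malg A int) (x : P i) :
  copower_obj phi := exist _ _ (pure_supp phi m x).

Lemma pure_is_zmod_morphism i phi m : zmod_morphism (@pure i phi m).
Proof.
by move=> x y; apply: dsum_eq => a; rewrite /dcoord /= raddfB mulrzBl.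
Qed.

HB.instance Definition _ i phi m :=
  GRing.isZmodMorphism.Build (P i : zmodType) (copower_obj phi)
    (@pure i phi m) (@pure_is_zmod_morphism i phi m).

Lemma pureD i phi m m' (x : P i) :
  pure phi (m + m') x = pure phi m x + pure phi m' x.
Proof. by apply: dsum_eq => a; rewrite /dcoord /= mcoeffD mulrzDr. Qed.

Lemma pureU i (phi : copower_cat) a (x : P i) :
  pure phi (mkmalgU a 1) x = dsum_in (bond i (phi a) x).
Proof.
apply: dsum_eq => b; rewrite /dcoord /= mcoeffU.
have [<-|/eqP ab] := eqVneq a b; first by rewrite dsum_in_funE.
by rewrite dsum_in_fun0.
Qed.

Lemma pure_dmor i k phi m (s : shom k i) (x : P k) : below i phi m ->
  pure phi m (dmor P s x) = pure phi m x.
Proof.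
move=> im; apply: dsum_eq => a; rewrite /dcoord /=.
have [/im[t _]|/mcoeff_outdom->] := boolP (a \in msupp m); last by rewrite !mulr0z.
by rewrite (bondE t) (bondE (scomp t s)) (dmor_thin thinP t s (scomp t s)).
Qed.

Lemma copower_mor_pure i (phi psi : copower_cat) (c : shom phi psi) m (x : P i) :
  below i phi m -> copower_mor c (pure phi m x) = pure psi m x.
Proof.
move=> im; apply: dsum_eq => a; rewrite /dcoord /= raddfMz.
have [/im[t _]|/mcoeff_outdom->] := boolP (a \in msupp m); last by rewrite !mulr0z.
by rewrite (bondE t) (bondE (scomp (c a) t)) (dmor_thin thinP (c a) t (scomp (c a) t)).
Qed.

Lemma copower_mor_in (phi psi : copower_cat) (c : shom phi psi) a
    (x : (P (phi a) : zmodType)) :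
  copower_mor c (dsum_in x) = dsum_in (dmor P (c a) x : (P (psi a) : zmodType)).
Proof.
apply: dsum_eq => b; rewrite /dcoord /=.
have [<-|ab] := pselect (a = b); first by rewrite !dsum_in_funE.
by rewrite !dsum_in_fun0 // raddf0.
Qed.

Lemma below_down i k phi m (s : shom k i) : below i phi m -> below k phi m.
Proof. by move=> im a /im[t _]; exists (scomp t s). Qed.

(** Only finitely many of the objects [phi a] matter for [m], so they have a
    common lower bound. *)
Definition unit_idx (m : malg A int) (phi : copower_cat) : pro_idx P :=
  projT1 (cid (below_ex phi m)).

Lemma unit_idxP m phi : below (unit_idx m phi) phi m.
Proof. by rewrite /unit_idx; case: cid. Qed.

Definition unit_mor m phi : hom (P (unit_idx m phi)) (copower phi) :=
  [the {additive (P (unit_idx m phi) : zmodType) -> copower_obj phi} of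
     pure phi m].

Lemma unit_compat m (phi psi : pro_idx copower) (c : shom phi psi) :
  germ_eq (dmor copower c \oc unit_mor m phi) (unit_mor m psi).
Proof.
have [k [s t]] := lower_bound (unit_idx m phi) (unit_idx m psi).
exists k, s, t => x /=; have U := @unit_idxP m.
rewrite !pure_dmor // copower_mor_pure //; exact: below_down s _.
Qed.

(** The morphism from [P] to the direct sum given by an element [m] of the free
    abelian group on [A]. *)
Definition copower_unit (m : malg A int) : hom P copower :=
  @ProHom Ab P copower (unit_idx m) (unit_mor m) (@unit_compat m).

Lemma copower_unitD : pro_additive copower_unit.
Proof.
move=> m m' phi; set p := lower_bound (unit_idx m phi) (unit_idx m' phi).
have [k [s t]] := lower_bound (unit_idx (m + m') phi) (tag p).
exists k, s, t => x /=; have U n := @unit_idxP n phi.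
rewrite !pure_dmor //; first exact: pureD.
- exact: below_down (tagged p).2 _.
- exact: below_down (tagged p).1 _.
Qed.

Lemma unit_idxU a phi : exists s : shom (unit_idx (mkmalgU a 1) phi) (phi a), True.
Proof. by apply: unit_idxP; rewrite -mcoeff_neq0 mcoeffUU. Qed.

(** On the generator of index [a], the unit is the inclusion of the summand of
    index [a]. *)
Lemma unit_morU a phi i (s : shom i (unit_idx (mkmalgU a 1) phi))
    (t : shom i (phi a)) x :
  unit_mor (mkmalgU a 1) phi (dmor P s x) =
  dsum_in (dmor P t x : (P (phi a) : zmodType)).
Proof.
have [u _] := unit_idxU a phi.
by rewrite /= pureU (bondE u) (dmor_thin thinP u s t).
Qed.

Section Extension.
Variables (N : ProZ) (v : malg A int -> hom P N).

Definition copower_ext_idx (j : pro_idx N) : copower_cat :=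
  fun a => ph_idx (v (mkmalgU a 1)) j.

Definition copower_ext_mor (j : pro_idx N) :
    hom (copower (copower_ext_idx j)) (N j) :=
  [the {additive copower_obj (copower_ext_idx j) -> (N j : zmodType)} of
    dsum_ext (fun a => v (mkmalgU a 1) j)].

(** The levels at which the components of index [a] become compatible depend on
   [a]; chosen together they form one object of the index category of the direct
   sum. *)
Lemma copower_ext_compat (j j' : pro_idx N) (c : shom j j') :
  @germ_eq Ab copower (N j') _ _ (dmor N c \oc copower_ext_mor j)
    (copower_ext_mor j').
Proof.
have /choice[psi Epsi] a : exists k, exists
    (s : shom k (copower_ext_idx j a)) (t : shom k (copower_ext_idx j' a)),
    dmor N c \oc v (mkmalgU a 1) j \oc dmor P s =c v (mkmalgU a 1) j' \oc dmor P t.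
  by have [k [s [t E]]] := ph_compat (v (mkmalgU a 1)) c; exists k, s, t.
pose s : @shom copower_cat psi (copower_ext_idx j) := fun a => projT1 (cid (Epsi a)).
pose t : @shom copower_cat psi (copower_ext_idx j') :=
  fun a => projT1 (cid (projT2 (cid (Epsi a)))).
exists psi, s, t; apply: additive_dsum_eq => a x /=.
rewrite !copower_mor_in !dsum_ext_in.
exact: (projT2 (cid (projT2 (cid (Epsi a)))) x).
Qed.

(** The morphism from the direct sum whose restriction to the copy of [P] of
    index [a] is [v] at the generator [a]. *)
Definition copower_ext : hom copower N :=
  @ProHom Ab copower N copower_ext_idx copower_ext_mor copower_ext_compat.

Lemma copower_extU a :
  copower_ext \oc copower_unit (mkmalgU a 1) =c v (mkmalgU a 1).
Proof.
move=> j; set phi := copower_ext_idx j.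
have [s _] := unit_idxU a phi.
exists (unit_idx (mkmalgU a 1) phi), (sid _), s => x.
by have /= -> := @unit_morU a phi _ (sid _) s x; rewrite dsum_ext_in.
Qed.

Lemma copower_ext_unique (w w' : hom copower N) :
  (forall a, w \oc copower_unit (mkmalgU a 1) =c
             w' \oc copower_unit (mkmalgU a 1)) -> w =c w'.
Proof.
move=> E j; set phi := ph_idx w j; set phi' := ph_idx w' j.
have /choice[psi Epsi] a : exists k, exists
    (s : shom k (unit_idx (mkmalgU a 1) phi))
    (t : shom k (unit_idx (mkmalgU a 1) phi')),
    w j \oc unit_mor (mkmalgU a 1) phi \oc dmor P s =c
    w' j \oc unit_mor (mkmalgU a 1) phi' \oc dmor P t.
  by have [k [s [t Ek]]] := E a j; exists k, s, t.
pose s : @shom copower_cat psi phi := fun a =>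
  scomp (projT1 (cid (unit_idxU a phi))) (projT1 (cid (Epsi a))).
pose t : @shom copower_cat psi phi' := fun a =>
  scomp (projT1 (cid (unit_idxU a phi')))
    (projT1 (cid (projT2 (cid (Epsi a))))).
exists psi, s, t; apply: additive_dsum_eq => a x /=.
rewrite !copower_mor_in.
rewrite -(unit_morU (projT1 (cid (Epsi a)))).
rewrite -(unit_morU (projT1 (cid (projT2 (cid (Epsi a)))))).
exact: (projT2 (cid (projT2 (cid (Epsi a)))) x).
Qed.

End Extension.

Lemma copower_tensorP (N : ProZ) (v : malg A int -> hom P N) : pro_additive v ->
  exists2 w : hom copower N, (forall m, w \oc copower_unit m =c v m) &
    forall w' : hom copower N, (forall m, w' \oc copower_unit m =c v m) -> w' =c w.
Proof.
move=> vD; exists (copower_ext v); last first.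
  move=> w' Ew'; apply: copower_ext_unique => a.
  exact: heq_trans (Ew' _) (heq_sym (copower_extU _ _)).
apply: pro_additive_eq => // [m m'|a]; last exact: copower_extU.
apply: heq_trans (pro_comp_add _ _ _).
exact: ccomp_heq (heq_refl _) (copower_unitD _ _).
Qed.

(** The direct sum of copies of [P] indexed by [A] is the tensor product of [P]
    with the free abelian group on [A]. *)
Definition free_tensor : tensor P (malg A int) :=
  Tensor copower_unitD copower_tensorP.

End FreeTensor.

(** * Discrete spaces *)

(** The set [S] with the discrete topology. *)
Definition disc (S : choiceType) : Type := S.

Section Discrete.
Variable S : choiceType.

(* Every set is open. *)
Let dopen (U : set (disc S)) := True.

Let dopenT : dopen setT. Proof. by []. Qed.
Let dopenI : setI_closed dopen. Proof. by []. Qed.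
Let dopen_bigU (I : Type) (f : I -> set (disc S)) :
  (forall i, dopen (f i)) -> dopen (\bigcup_i f i).
Proof. by []. Qed.

HB.instance Definition _ := Choice.on (disc S).
HB.instance Definition _ :=
  @isOpenTopological.Build (disc S) dopen dopenT dopenI dopen_bigU.

Lemma disc_open (U : set (disc S)) : open U.
Proof. exact: (Logic.I : dopen U). Qed.

Lemma disc_continuous (Y : topologicalType) (f : disc S -> Y) : continuous f.
Proof. by apply/continuousP => U _; exact: disc_open. Qed.

Definition disc_map (Y : topologicalType) (f : disc S -> Y) :
    continuousType (disc S) Y :=
  [the continuousType _ _ of mkcts (@disc_continuous Y f)].

(** The faces of the zero-dimensional complex with vertex set [S]. *)
Definition point_face : set {fset S} := [set s | exists v, s = [fset v]%fset].

Lemma point_face_neq0 s : point_face s -> s != fset0.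
Proof. by move=> [v ->]; apply/fset0Pn; exists v; rewrite inE. Qed.

Lemma point_face1 v : point_face [fset v]%fset.
Proof. by exists v. Qed.

Lemma point_face_sub s t :
  point_face s -> (t `<=` s)%fset -> t != fset0 -> point_face t.
Proof.
move=> [v ->]; rewrite fsubset1 => /orP[/eqP-> _|/eqP->]; last by rewrite eqxx.
by exists v.
Qed.

Definition points : simplicial_complex :=
  SimplicialComplex point_face_neq0 point_face1 point_face_sub.

Variable R : realType.

Definition dirac_coord (v w : S) : R := (v == w)%:R.

Lemma dirac_barycentric v : @barycentric R points (dirac_coord v).
Proof.
split=> [w|]; first exact: ler0n.
exists [fset v]%fset; split; first exact: point_face1.
  by move=> w; rewrite inE eq_sym /dirac_coord => /negbTE ->.
by rewrite big_seq_fset1 /dirac_coord eqxx.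
Qed.

(** The vertex [v] as a point of the realization; every point is of this
    form. *)
Definition dirac_point (v : disc S) : polyhedron R points :=
  exist _ _ (dirac_barycentric v).

Lemma realization_eq (K : simplicial_complex) (x y : realization R K) :
  (forall v, sval x v = sval y v) -> x = y.
Proof.
case: x y => f Pf [g Pg] E.
have Efg : f = g by exact: functional_extensionality_dep.
by case: g / Efg Pg {E} => Pg; rewrite (Prop_irrelevance Pf Pg).
Qed.

Lemma supported_dirac v (x : realization R points) :
  supported [fset v]%fset (sval x) -> x = dirac_point v.
Proof.
move=> xv; have [_ [s [_ sx s1]]] := svalP x; apply: realization_eq => w /=.
rewrite /dirac_coord; have [<-|vw] := eqVneq v w; last first.
  by rewrite xv // inE eq_sym.
have [vs|/sx xv0] := boolP (v \in s).
  rewrite -[RHS]s1 (big_rem v) //= big1_seq ?addr0 // => u /andP[_].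
  by rewrite mem_rem_uniq ?fset_uniq // inE => /andP[uv _]; rewrite xv // inE.
rewrite -[RHS]s1 big1_seq // => u _.
by have [->//|uv] := eqVneq u v; rewrite xv // inE.
Qed.

Lemma points_open (U : set (polyhedron R points)) : open U.
Proof.
suff: weakly_open U by [].
move=> s [v ->]; have [Uv|Uv] := pselect (U (dirac_point v)).
  by exists setT => [|x /supported_dirac ->]; [exact: openT|].
by exists set0 => [|x /supported_dirac ->]; [exact: open0|].
Qed.

Lemma dirac_surj (x : polyhedron R points) : exists v, x = dirac_point v.
Proof.
have [_ [s [[v ->] sx _]]] := svalP x.
by exists v; exact: supported_dirac.
Qed.

Lemma dirac_inj : injective dirac_point.
Proof.
move=> v w /(congr1 (fun x => sval x v)) /=; rewrite /dirac_coord eqxx.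
by have [//|_ /eqP] := eqVneq w v; rewrite oner_eq0.
Qed.

(** The inverse of [dirac_point]. *)
Definition the_point (x : polyhedron R points) : disc S :=
  projT1 (cid (dirac_surj x)).

Lemma the_pointE x : dirac_point (the_point x) = x.
Proof. by rewrite /the_point; case: cid. Qed.

Lemma the_point_continuous : continuous the_point.
Proof. by apply/continuousP => U _; exact: points_open. Qed.

Lemma homotopic_rel_ext (X Y : topologicalType) (B : set X) (f g : X -> Y) :
  continuous g -> f =1 g -> homotopic_rel R B f g.
Proof.
move=> cg fg; have cG : continuous (fun xt : cylinder R X => g xt.1).
  by move=> xt; apply: (continuous_comp (f := fst)); [exact: cvg_fst|exact: cg].
exists [the continuousType _ _ of mkcts cG] => [x|x t _]; last exact/esym/fg.
by split=> //; exact/esym/fg.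
Qed.

Lemma homotopic_ext (X Y : topologicalType) (f g : X -> Y) :
  continuous g -> f =1 g -> homotopic R f g.
Proof. by move=> cg fg; have [H HP _] := homotopic_rel_ext set0 cg fg; exists H. Qed.

Lemma disc_polyhedral : polyhedral_type R (disc S).
Proof.
exists points, (disc_map dirac_point).
exists [the continuousType _ _ of mkcts the_point_continuous]; split.
  apply: homotopic_ext => [v|v /=]; first exact: cvg_id.
  by apply: dirac_inj; rewrite the_pointE.
by apply: homotopic_ext => [x|x /=]; [exact: cvg_id|exact: the_pointE].
Qed.

End Discrete.

(** * Maps from the Fortissimo space to polyhedra *)

Lemma countable_subset (T : Type) (C D : set T) :
  C `<=` D -> countable D -> countable C.
Proof. by move=> /subset_card_le; exact: sub_countable. Qed.

Lemma countable_setU (T : Type) (C D : set T) :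
  countable C -> countable D -> countable (C `|` D).
Proof.
move=> cC cD; have : countable (\bigcup_(b in [set: bool]) if b then C else D).
  by apply: bigcup_countable => // -[].
by apply: countable_subset => x [Cx|Dx]; [exists true|exists false].
Qed.

Lemma continuous_compose (X Y Z : topologicalType) (f : X -> Y) (g : Y -> Z) :
  continuous f -> continuous g -> continuous (g \o f).
Proof. by move=> cf cg x; apply: continuous_comp; [exact: cf|exact: cg]. Qed.

Section Fortissimo.
Variable A : choiceType.

(** The Fortissimo space: every point [Some a] is isolated, and the
    neighbourhoods of [None] are the sets that contain [None] and have a
    countable complement. *)
Definition fort : Type := option A.

Definition fort_open (U : set fort) := U None -> countable [set a | ~ U (Some a)].

Lemma fort_openT : fort_open setT.
Proof.
move=> _; apply: (@sub_countable _ _ _ (@set0 A)) => //.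
by apply: subset_card_le => a /=; apply.
Qed.

Lemma fort_openI : setI_closed fort_open.
Proof.
move=> U V oU oV [/oU cU /oV cV].
have cUV : countable ([set a | ~ U (Some a)] `|` [set a | ~ V (Some a)]).
  exact: countable_setU.
apply: sub_countable cUV; apply: subset_card_le => a /= /not_andP.
by [].
Qed.

Lemma fort_open_bigU (I : Type) (f : I -> set fort) :
  (forall i, fort_open (f i)) -> fort_open (\bigcup_i f i).
Proof.
move=> fo [i _ /fo ci]; apply: sub_countable ci; apply: subset_card_le => a /= Na Nfa.
by apply: Na; exists i.
Qed.

HB.instance Definition _ := Choice.on fort.
HB.instance Definition _ :=
  @isOpenTopological.Build fort fort_open fort_openT fort_openI fort_open_bigU.

Lemma fort_openE (U : set fort) : open U = fort_open U.
Proof. by []. Qed.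

Section Maps.
Variable R : realType.

(** The set where [f] is at distance at least [1 / (n + 1)] from its value at
    [None] is countable for each [n]. *)
Lemma fort_real (f : fort -> R) : continuous f ->
  countable [set a | f (Some a) <> f None].
Proof.
move=> cf.
have cn n : countable [set a : A | ~ `|f None - f (Some a)| < n.+1%:R^-1].
  have /continuousP/(_ _ (ball_open (f None) _ : open (ball (f None) n.+1%:R^-1))) := cf.
  by rewrite fort_openE; apply; exact: ballxx.
have : countable (\bigcup_n [set a : A | ~ `|f None - f (Some a)| < n.+1%:R^-1]).
  by apply: bigcup_countable => // n _; exact: cn.
apply: sub_countable; apply: subset_card_le => a /= /eqP.
rewrite eq_sym -subr_eq0 -normr_gt0 => d0.
have [n nP] : exists n, n.+1%:R^-1 < `|f None - f (Some a)|.
  have /= := near_infty_natSinv_lt (PosNum d0) => -[n _ /(_ n (leqnn _))].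
  by exists n.
by exists n => //=; apply/negP; rewrite -leNgt ltW.
Qed.

Section Polyhedron.
Variable K : simplicial_complex.

(** Barycentric coordinates are continuous for the weak topology. *)
Lemma coord_continuous (v : vertex K) :
  continuous (fun x : polyhedron R K => sval x v).
Proof.
apply/continuousP => U oU; suff: weakly_open [set x : polyhedron R K | U (sval x v)] by [].
move=> s _; exists [set t : {ptws vertex K -> R} | U (t v)] => //.
apply: (@open_comp _ _ (fun t : {ptws vertex K -> R} => t v)) => // t _.
exact: (@proj_continuous (vertex K) (fun=> R) v).
Qed.

(** Barycentric coordinates that agree on a face carrying all the mass of one
    of the points agree everywhere. *)
Lemma barycentric_eq (x y : realization R K) (s : {fset vertex K}) :
  supported s (sval x) -> \sum_(v <- s) sval x v = 1 ->
  (forall v, v \in s -> sval y v = sval x v) -> x = y.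
Proof.
move=> sx x1 yx; apply: realization_eq => v.
have [/yx//|vs] := boolP (v \in s); rewrite sx //.
have [y0 [s' [_ sy y1]]] := svalP y.
have ys1 : \sum_(u <- s) sval y u = 1.
  by rewrite -x1; apply: eq_big_seq => u /yx.
have ysU : \sum_(u <- (s `|` s')%fset) sval y u = 1.
  rewrite -[RHS]y1; apply/esym/big_fset_incl; first exact: fsubsetUr.
  by move=> u _ /sy.
have [vs'|/sy//] := boolP (v \in s').
have s0 : \sum_(u <- (s `|` s')%fset | u \notin s) sval y u = 0.
  apply: (@addrI _ 1); rewrite addr0 -[RHS]ysU [RHS](bigID (mem s)) /=.
  congr (_ + _); rewrite -[LHS]ys1 [RHS]big_mkcond /=.
  rewrite (eq_big_seq (fun u => if u \in s then sval y u else 0)) => [|u /= ->//].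
  apply: big_fset_incl; first exact: fsubsetUl.
  by move=> u _ /negbTE ->.
move/eqP: s0; rewrite psumr_eq0 => [/allP/(_ v)|//]; rewrite in_fsetU vs' orbT vs /=.
by move=> /(_ isT)/eqP.
Qed.

(** By [barycentric_eq] it suffices to apply [fort_real] to the finitely many
    barycentric coordinates that do not vanish at [f None]. *)
Lemma fort_polyhedron (f : fort -> polyhedron R K) : continuous f ->
  countable [set a | f (Some a) <> f None].
Proof.
move=> cf; have [_ [s [_ sf f1]]] := svalP (f None).
have cs : countable (\bigcup_(v in [set` s])
    [set a | sval (f (Some a)) v <> sval (f None) v]).
  apply: bigcup_countable => [|v _]; first exact/finite_set_countable/finite_fset.
  apply: (@fort_real (fun x => sval (f x) v)).
  exact: continuous_compose cf (@coord_continuous v).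
apply: sub_countable cs; apply: subset_card_le => a /= Na.
apply: contrapT => Nv; apply: Na; apply/esym/(barycentric_eq sf f1) => v vs.
by apply: contrapT => av; apply: Nv; exists v.
Qed.

End Polyhedron.
End Maps.
End Fortissimo.

Section Cylinder.
Variable R : realType.

Definition clamp_fun (u : R) : R := Num.max 0 (Num.min u 1).

Lemma clamp_subproof u : clamp_fun u \in `[0 : R, 1 : R]%classic.
Proof.
apply: mem_set; rewrite /= in_itv /= /clamp_fun le_max lexx /=.
by rewrite ge_max ler01 ge_min lexx orbT.
Qed.

(** The retraction of the real line onto the unit interval. *)
Definition clamp (u : R) : unit_interval R :=
  exist (fun v => v \in `[0 : R, 1 : R]%classic) _ (clamp_subproof u).

Lemma clampK (t : unit_interval R) : clamp (sval t) = t.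
Proof.
case: t => t tP; apply: val_inj; rewrite /= /clamp_fun.
have /= := set_mem tP; rewrite in_itv /= => /andP[t0 t1].
by rewrite min_l // max_r.
Qed.

Lemma clamp_continuous : continuous clamp.
Proof.
have c1 : continuous (cst 1 : R -> R) by exact: cst_continuous.
have c0 : continuous (cst 0 : R -> R) by exact: cst_continuous.
have cmin u : {for u, continuous (idfun \min cst 1 : R -> R)}.
  by apply: continuous_min => //; exact: c1.
apply: continuous_comp_initial => u.
exact: (@continuous_max R R (cst 0) (idfun \min cst 1) u (c0 u) (cmin u)).
Qed.

(** Continuous real functions on the unit interval that agree at the images of
    the rational numbers are equal. *)
Lemma unit_interval_rat_eq (f g : unit_interval R -> R) :
  continuous f -> continuous g ->
  (forall q, f (clamp (ratr q)) = g (clamp (ratr q))) -> f =1 g.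
Proof.
move=> cf cg E t; rewrite -(clampK t); apply: contrapT => ne.
pose h u := f (clamp u) - g (clamp u).
have ch : continuous h.
  move=> u; apply: continuousB.
    exact: (continuous_compose clamp_continuous cf).
  exact: (continuous_compose clamp_continuous cg).
have oh : open (h @^-1` [set~ 0]).
  by apply: open_comp => [x _|]; [exact: ch|exact/closed_openC/closed_eq].
have [|u [hu [q _ uq]]] := dense_rat _ oh.
  by exists (sval t); apply/eqP; rewrite subr_eq0; exact/eqP.
by apply: hu; rewrite -uq /h E subrr.
Qed.

Lemma pair_continuous (X Y Z : topologicalType) (f : X -> Y) (g : X -> Z) :
  continuous f -> continuous g -> continuous (fun x => (f x, g x)).
Proof.
move=> cf cg x W [[P Q] /= [fP gQ] PQ]; 
have fP' : nbhs x (f @^-1` P) by exact: cf fP.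
have gQ' : nbhs x (g @^-1` Q) by exact: cg gQ.
suff: nbhs x ((fun x => (f x, g x)) @^-1` W) by [].
by apply: filterS (filterI fP' gQ') => y [fy gy]; apply: PQ.
Qed.

Lemma cylinder_slice (X Y : topologicalType) (F : cylinder R X -> Y) x :
  continuous F -> continuous (fun t => F (x, t)).
Proof.
move=> cF; have cp : continuous (fun t => (x, t) : cylinder R X).
  have c1 : continuous (cst x : unit_interval R -> X) by exact: cst_continuous.
  have c2 : continuous (@id (unit_interval R)) by move=> t; exact: cvg_id.
  exact: pair_continuous c1 c2.
exact: continuous_compose cp cF.
Qed.

Lemma disc_cylinder_continuous (S : choiceType) (Y : topologicalType)
    (h : S -> unit_interval R -> Y) : (forall s, continuous (h s)) ->
  continuous (fun st : cylinder R (disc S) => h st.1 st.2).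
Proof.
move=> ch [s t] W /= Wst; exists ([set s : disc S], h s @^-1` W) => /=.
  split; last exact: ch.
  by apply: open_nbhs_nbhs; split=> //; exact: disc_open.
by move=> [s' t'] [/= -> ].
Qed.

(** A family of paths indexed by a discrete space, as a homotopy. *)
Definition disc_homotopy (S : choiceType) (Y : topologicalType)
    (h : S -> continuousType (unit_interval R) Y) :
    continuousType (cylinder R (disc S)) Y :=
  [the continuousType _ _ of mkcts (@disc_cylinder_continuous S Y h
     (fun s => @cts_fun _ _ (h s)))].

(** A homotopy of maps from the Fortissimo space to a polyhedron is, off a
    countable set, the constant family of paths given by its value at [None]. *)
Lemma fort_homotopy (A : choiceType) (K : simplicial_complex)
    (F : cylinder R (fort A) -> polyhedron R K) : continuous F ->
  countable [set a | exists t, F (Some a, t) <> F (None, t)].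
Proof.
move=> cF.
have cF_ u : continuous (fun x : fort A => F (x, u)).
  have cp : continuous (fun x : fort A => (x, u) : cylinder R (fort A)).
    have c1 : continuous (@id (fort A)) by move=> x; exact: cvg_id.
    have c2 : continuous (cst u : fort A -> unit_interval R).
      exact: cst_continuous.
    exact: pair_continuous c1 c2.
  exact: continuous_compose cp cF.
have : countable (\bigcup_(q in [set: rat])
    [set a | F (Some a, clamp (ratr q)) <> F (None, clamp (ratr q))]).
  by apply: bigcup_countable => // q _; exact: fort_polyhedron (cF_ _).
apply: countable_subset => a /= [t Nt]; apply: contrapT => Nq; apply: Nt.
apply: realization_eq => v.
apply: (@unit_interval_rat_eq (fun u => sval (F (Some a, u)) v)
  (fun u => sval (F (None, u)) v)).
- exact: continuous_compose (cylinder_slice cF) (@coord_continuous R K v).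
- exact: continuous_compose (cylinder_slice cF) (@coord_continuous R K v).
- move=> q; congr (sval _ v); apply: contrapT => ne; apply: Nq.
  by exists q.
Qed.

End Cylinder.

(** * A strong polyhedral expansion of the Fortissimo space *)

Section Expansion.
Variables (R : realType) (A : choiceType).

(** The countable subsets of [A], with one arrow from [C] to [D] when [D] is
    contained in [C]. *)
Definition csets : small_cat.
Proof.
refine (@SmallCat {C : set A | countable C}
  (fun C D => sval D `<=` sval C) (fun C => @subset_refl _ (sval C))
  (fun C D E ED DC => subset_trans ED DC) _ _ _) => *; exact: Prop_irrelevance.
Defined.

Definition cset (C : set A) (cC : countable C) : csets := exist _ C cC.

Lemma csets_thin (C D : csets) (a b : shom C D) : a = b.
Proof. exact: (@Prop_irrelevance (sval D `<=` sval C)). Qed.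

Lemma csetsP : cofiltrant csets.
Proof.
split=> [|C D|C D a b].
- by constructor; apply: (@cset set0); exact: countable0.
- exists (cset (countable_setU (svalP C) (svalP D))).
  by split; constructor=> x; [left|right].
- by exists C, (sid C); exact: csets_thin.
Qed.

(** The points of the quotient of the Fortissimo space that collapses the
    complement of [C] to [None]: the set [C] with one extra point. *)
Definition level (C : csets) : choiceType := option {a : A | a \in sval C}.

(** The inclusion of the points of a level, and the quotient map. *)
Definition level_in (C : csets) (x : level C) : option A := omap val x.
Definition collapse (C : csets) (x : option A) : level C := obind insub x.

Arguments collapse : simpl never.

Lemma level_inK C : cancel (@level_in C) (@collapse C).
Proof. by case=> [c|] //=; rewrite /collapse /= valK. Qed.

Lemma collapse_in C a : sval C a -> level_in (collapse C (Some a)) = Some a.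
Proof. by move=> Ca; rewrite /collapse /= insubT ?inE //=; exact: mem_set. Qed.

Lemma collapse_out C a : ~ sval C a -> collapse C (Some a) = None.
Proof. by move=> Ca; rewrite /collapse /= insubF //; apply/negbTE/negP => /set_mem. Qed.

Lemma collapse_collapse (C D : csets) (a : shom C D) x :
  collapse D (level_in (collapse C x)) = collapse D x.
Proof.
case: x => // b; have [Cb|Cb] := pselect (sval C b); first by rewrite collapse_in.
by rewrite !collapse_out // => /a.
Qed.

Definition level_map (C D : csets) (x : disc (level C)) : disc (level D) :=
  collapse D (level_in x).

(** The inverse system of the levels, as discrete spaces. *)
Definition fort_diag : diagram csets (POL R).
Proof.
refine (@Diagram csets (POL R)
  (fun C => exist _ (disc (level C) : topologicalType) (disc_polyhedral (level C) R))
  (fun C D _ => disc_map (@level_map C D)) _ _).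
- by move=> C x; exact: level_inK.
- by move=> C D E b a x; apply/esym; exact: (collapse_collapse b).
Defined.

Definition fort_sys : Pro (POL R) := ProObj csetsP fort_diag.

Lemma collapse_continuous C :
  continuous (collapse C : fort A -> disc (level C)).
Proof.
apply/continuousP => U _; rewrite fort_openE => UN.
apply: countable_subset (svalP C) => a /= Ua; apply: contrapT => Ca.
by apply: Ua; rewrite collapse_out.
Qed.

Lemma collapse_compat (C D : pro_idx fort_sys) (a : shom C D) (x : fort A) :
  dmor fort_sys a (collapse C x) = collapse D x.
Proof. exact: collapse_collapse. Qed.

Definition fort_proj : projection (fort A) fort_sys :=
  @Projection R (fort A) fort_sys
    (fun C => [the continuousType _ _ of mkcts (@collapse_continuous C)])
    collapse_compat.

(** Every map from the Fortissimo space to a polyhedron is constant off a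
    countable set, so it factors through some level of the system. *)
Lemma fort_S1 : strong_expansion_S1 fort_proj.
Proof.
move=> K f; pose C := cset (fort_polyhedron (@cts_fun _ _ f)).
exists C, (disc_map (fun x => f (level_in x))).
apply: homotopic_ext => [|x].
  exact: continuous_compose (@collapse_continuous C) (@disc_continuous _ _ _).
transitivity (f (level_in (collapse C x))) => //; case: x => // a.
have [Ca|Ca] := pselect (sval C a); first by rewrite collapse_in.
by rewrite collapse_out //; exact: contrapT.
Qed.

(** The paths of the given homotopy at the points of a deep enough level already
    form the required homotopy [H]: its composite with the projection is [F]
    itself. *)
Lemma fort_S2 : strong_expansion_S2 fort_proj.
Proof.
move=> K C h0 h1 F hF.
pose D := cset (countable_setU (svalP C) (fort_homotopy (@cts_fun _ _ F))).
have DC : @shom csets D C by move=> a Ca; left.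
exists D, DC.
pose H := disc_homotopy (fun x : level D => [the continuousType _ _ of
  mkcts (cylinder_slice (x := level_in x : fort A) (@cts_fun _ _ F))]).
have HE x t : H (collapse D x, t) = F (x, t).
  transitivity (F (level_in (collapse D x), t)) => //; case: x => // a.
  have [Da|Da] := pselect (sval D a); first by rewrite collapse_in.
  rewrite collapse_out //=; apply: contrapT => ne.
  by apply: Da; right; exists t => /esym.
exists H; split; last first.
  by apply: homotopic_rel_ext => [|[x t]]; [exact: cts_fun|exact: HE].
move=> x; have [F0 F1] := hF (level_in x : fort A).
have HF t : H (x, t) = F (level_in x, t) by [].
by rewrite !HF F0 F1.
Qed.

Lemma fort_strong_expansion : strong_expansion fort_proj.
Proof. by split; [exact: fort_S1|exact: fort_S2]. Qed.

(** The Fortissimo space as an object of the strong shape category. *)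
Definition fort_ssh : SSh R := SShObj fort_strong_expansion.

End Expansion.

(** * Homology in degree zero *)

Section DegreeZero.
Variable R : realType.

Lemma hclassD n X G (z z' : cycles R n X G) : hclass (z + z') = hclass z + hclass z'.
Proof. by rewrite /hclass raddfD. Qed.

Lemma chain_map_coefD n (X Y : topologicalType) (G G' : zmodType)
    (f : continuousType X Y) (g g' h : {additive G -> G'}) c :
  (forall x, h x = g x + g' x) ->
  chain_map R n f h c = chain_map R n f g c + chain_map R n f g' c.
Proof.
move=> E; elim/chain_ind: c => [|c d Ec Ed|s x].
- by rewrite !raddf0 addr0.
- by rewrite !raddfD Ec Ed addrACA.
- by rewrite !chain_mapU E raddfD.
Qed.

Lemma homology_fun_coefD n (X Y : topologicalType) (G G' : zmodType)
    (f : continuousType X Y) (g g' h : {additive G -> G'}) (c : homology R n X G) :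
  (forall x, h x = g x + g' x) ->
  homology_fun f h c = homology_fun f g c + homology_fun f g' c.
Proof.
move=> E; have [z ->] := hclass_surj c; rewrite !homology_funE -hclassD.
by congr hclass; apply: val_inj; exact: chain_map_coefD.
Qed.

Lemma const_continuous (X Y : topologicalType) (y : Y) : continuous (fun _ : X => y).
Proof. exact: cst_continuous. Qed.

(** The singular simplex of dimension zero at the point [x]. *)
Definition point_simplex (X : topologicalType) (x : X) : sing R 0 X :=
  [the continuousType _ _ of mkcts (@const_continuous (std_simplex R 0) X x)].

Definition point_cycle (X : topologicalType) (x : X) : cycles R 0 X int :=
  exist (fun c => c \in @is_cycle R 0 X int) (mkmalgU (point_simplex x) 1) erefl.

(** The generator of the zeroth homology group given by a point. *)
Definition point_class (X : topologicalType) (x : X) : homology R 0 X int :=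
  hclass (point_cycle x).

Lemma homology_fun_point (X Y : topologicalType) (f : continuousType X Y) x :
  homology_fun f [the {additive int -> int} of idfun] (point_class x) =
  point_class (f x).
Proof.
rewrite /point_class homology_funE; congr hclass; apply: val_inj.
by rewrite /= chain_mapU; congr mkmalgU; exact/continuousEP.
Qed.

Section Simplex.
Variable n : nat.
Implicit Types x y : std_simplex R n.

Definition segment_coord x y (u : R) (i : 'I_n.+1) : R :=
  sval x i + sval (clamp u) * (sval y i - sval x i).

Lemma segment_subproof x y (u : R) :
  (segment_coord x y u : {ptws 'I_n.+1 -> R}) \in @simplex_set R n.
Proof.
apply: mem_set; have [x0 x1] := set_mem (svalP x).
have [y0 y1] := set_mem (svalP y).
have := set_mem (svalP (clamp u)); rewrite /= in_itv /= => /andP[u0 u1].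
split=> [i|]; last first.
  by rewrite big_split /= x1 -mulr_sumr sumrB x1 y1 subrr mulr0 addr0.
rewrite /segment_coord mulrBr addrCA addrC -[X in X - _]mul1r -mulrBl.
by rewrite addr_ge0 // mulr_ge0 ?x0 ?y0 // subr_ge0.
Qed.

(** The straight path from [x] to [y], constant outside the unit interval. *)
Definition segment x y (u : R) : std_simplex R n :=
  exist (fun t => t \in @simplex_set R n) _ (segment_subproof x y u).

Lemma segment0 x y : segment x y 0 = x.
Proof.
apply: val_inj; apply: functional_extensionality_dep => i /=.
by rewrite /segment_coord /= /clamp_fun min_l // max_l // mul0r addr0.
Qed.

Lemma segment1 x y : segment x y 1 = y.
Proof.
apply: val_inj; apply: functional_extensionality_dep => i /=.
by rewrite /segment_coord /= /clamp_fun min_l // max_r // mul1r addrC subrK.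
Qed.

Lemma segment_coord_continuous x y i :
  continuous (fun u => segment_coord x y u i).
Proof.
have cv : continuous (set_val : unit_interval R -> R) by exact: initial_continuous.
have cc : continuous (fun u => sval (clamp u) : R).
  exact: continuous_compose (@clamp_continuous R) cv.
move=> u; apply: (@cvgD _ R); first exact: cvg_cst.
by apply: cvgM; [exact: cc|exact: cvg_cst].
Qed.

Lemma segment_continuous x y : continuous (segment x y).
Proof.
apply: continuous_comp_initial => u.
have Ff : Filter (fmap (set_val \o segment x y) (nbhs u)).
  exact: fmap_filter (nbhs_filter u).
apply/cvg_sup => j.
apply/cvg_image; first by rewrite eqEsubset; split=> v // _; exists (cst v).
move=> W /= Wt; exists ((fun t : 'I_n.+1 -> R => t j) @^-1` W); last first.
  by rewrite eqEsubset; split => [j' [? + <-//]|j' Wj]; exists (cst j').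
exact: (@segment_coord_continuous x y j u W).
Qed.

(** Standard simplices are path-connected, so a singular simplex of a discrete
    space is constant. *)
Lemma disc_simplex_const (S : choiceType) (s : std_simplex R n -> disc S) x y :
  continuous s -> s x = s y.
Proof.
move=> cs; apply: contrapT => /eqP sxy.
pose f := (fun v : disc S => (v == s y)%:R : R) \o s \o segment x y.
have cf : continuous f.
  apply: continuous_compose (@segment_continuous x y) _.
  exact: continuous_compose cs (@disc_continuous _ _ _).
have f0 : f 0 = 0 by rewrite /f /= segment0 (negbTE sxy).
have f1 : f 1 = 1 by rewrite /f /= segment1 eqxx.
(* The composite of [s] with the path from [x] to [y] would give a continuous
   real function that takes the values 0 and 1 only. *)
have [||u _ fu] := @IVT R f 0 1 2^-1 ler01 _ _.
- exact: continuous_subspaceT.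
- by rewrite f0 f1 min_l // max_r // invr_ge0 ler0n invf_le1 ?ler1n.
move: fu; rewrite /f /=; case: eqP => _ /eqP.
  by rewrite eq_sym invr_eq1 (eqr_nat _ 2 1).
by rewrite eq_sym invr_eq0 pnatr_eq0.
Qed.

End Simplex.

Lemma vertex_subproof :
  ((fun=> 1) : {ptws 'I_1 -> R}) \in @simplex_set R 0.
Proof. by apply: mem_set; split=> [i|]; rewrite ?ler01 // big_ord1. Qed.

Definition std_vertex : std_simplex R 0 :=
  exist (fun t => t \in @simplex_set R 0) _ vertex_subproof.

Section Multiplicity.
Variables (S : choiceType) (x : S).

(** The homomorphism that multiplies by one if [s] is the simplex at [x] and by
    zero otherwise. *)
Definition mult_gen (s : sing R 0 (disc S)) : {additive int -> int} :=
  [the {additive int -> int} of times_fun ((s std_vertex == x)%:R : int)].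

(** The multiplicity at [x] of a zero-dimensional chain on a discrete space. *)
Definition multiplicity : {additive chain R 0 (disc S) int -> int} :=
  [the {additive _ -> _} of lin_ext mult_gen].

(** The two ends of a singular 1-simplex coincide and enter the boundary with
    opposite signs. *)
Lemma multiplicity_bdry c : multiplicity (bdry R 0 (disc S) int c) = 0.
Proof.
elim/chain_ind: c => [|c d Ec Ed|s g]; first by rewrite !raddf0.
  by rewrite !raddfD Ec Ed addr0.
rewrite bdryU /bdry_gen raddf_sum /= big_ord_recl big_ord1 !lin_extU /=.
rewrite /times_fun (disc_simplex_const (face_incl R ord0 std_vertex)
  (face_incl R (lift ord0 ord0) std_vertex) (@cts_fun _ _ s)).
by rewrite -mulrzDr expr0 expr1 mulr1z mulrN1z subrr mulr0z.
Qed.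

End Multiplicity.

(** Distinct points of a discrete space are not homologous. *)
Lemma point_class_inj (S : choiceType) : injective (@point_class (disc S)).
Proof.
move=> x y /hclass_eq[b /(congr1 (@multiplicity S x)) E].
have := etrans E (@multiplicity_bdry S x b).
rewrite raddfB /= !lin_extU /= /times_fun /= eqxx.
by have [->//|_] := eqVneq y x.
Qed.

Lemma bar_additive (n : nat) (G : zmodType) (X : Pro (POL R)) :
  pro_additive (@bar R n G X).
Proof.
move=> a b j; set p := @lower_bound (pro_homology R n int X) j j.
have [_ _ /(_ _ _ (tagged p).1 (tagged p).2)[k [c Ec]]] := pro_idxP X.
exists k, (scomp (tagged p).1 c), c => x.
rewrite /= /germ_add /=.
have /= E1 := dmor_comp (pro_homology R n int X) (tagged p).1 c x.
have /= E2 := dmor_comp (pro_homology R n int X) (tagged p).2 c x.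
rewrite -E1 -E2 -Ec; apply: homology_fun_coefD => z.
by rewrite /= /times_fun mulrzDl.
Qed.

End DegreeZero.

(** * Failure of injectivity of the pairing *)

Section NotMono.
Variables (R : realType) (A : choiceType).
Hypothesis uncountableA : ~ countable [set: A].

Let P : ProZ := proH 0 (fort_ssh R A) int.

(** The inverse system of the free abelian groups on the complements of the
    countable subsets of [A], with inclusions as bonding maps. *)
(** The complement of [C]. *)
Definition tail (C : csets A) : choiceType := {a : A | a \notin sval C}.

Lemma tail_subproof (C D : csets A) (s : shom C D) (a : tail C) :
  val a \notin sval D.
Proof. by apply/negP => /set_mem/s/mem_set aC; have := svalP a; rewrite aC. Qed.

Definition tail_incl (C D : csets A) (s : shom C D) (a : tail C) : tail D :=
  exist (fun a => a \notin sval D) (val a) (tail_subproof s a).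

Definition tail_obj (C : csets A) : zmodType := malg (tail C) int.

Definition tail_mor (C D : csets A) (s : shom C D) :
    {additive tail_obj C -> tail_obj D} :=
  [the {additive _ -> _} of lin_ext (fun a : tail C =>
     [the {additive int -> tail_obj D} of mkmalgU (tail_incl s a)])].

Lemma tail_morU (C D : csets A) (s : shom C D) (a : tail C) z :
  tail_mor s (mkmalgU a z) = mkmalgU (tail_incl s a) z.
Proof. exact: lin_extU. Qed.

Lemma additive_tail_eq (C : csets A) (B : zmodType)
    (u v : {additive tail_obj C -> B}) :
  (forall a z, u (mkmalgU a z) = v (mkmalgU a z)) -> u =1 v.
Proof.
move=> E x; elim/chain_ind: x => [|x y Ex Ey|//]; first by rewrite !raddf0.
by rewrite !raddfD Ex Ey.
Qed.

Definition tail_diag : diagram (csets A) Ab.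
Proof.
refine (@Diagram (csets A) Ab tail_obj tail_mor _ _).
- move=> C; apply: additive_tail_eq => a z; rewrite tail_morU /=.
  by congr mkmalgU; apply: val_inj.
- move=> C D E b a; apply: (@additive_tail_eq _ _ _
    [the {additive _ -> _} of tail_mor b \o tail_mor a]) => c z.
  by rewrite /= !tail_morU; congr mkmalgU; apply: val_inj.
Defined.

Definition tails : ProZ := ProObj (csetsP A) tail_diag.

(** The difference in the zeroth homology of the level [C] of the classes of the
    images of [Some a] and [None]. *)
Definition diff_class (C : csets A) (a : A) : (P C : zmodType) :=
  point_class R (collapse C (Some a) : disc (level C)) -
  point_class R (collapse C None : disc (level C)).

Lemma diff_class_dmor (C D : csets A) (s : shom C D) a :
  dmor P s (diff_class C a) = diff_class D a.
Proof.
have E x : dmor P s (point_class R (collapse C x : disc (level C))) =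
    point_class R (collapse D x : disc (level D)).
  rewrite [LHS]homology_fun_point; congr point_class; exact: collapse_collapse.
by rewrite /diff_class raddfB !E.
Qed.

Lemma diff_class_out C a : ~ sval C a -> diff_class C a = 0.
Proof. by move=> Ca; rewrite /diff_class collapse_out // subrr. Qed.

Lemma diff_class_neq0 C a : sval C a -> diff_class C a <> 0.
Proof.
move=> Ca /eqP; rewrite subr_eq0 => /eqP/point_class_inj E.
by have := collapse_in Ca; rewrite E.
Qed.

Lemma fort_thin : thin (pro_idx P).
Proof. exact: csets_thin. Qed.

Notation T := (copower A fort_thin).

Definition tail_to_copower_mor (C : csets A) (phi : pro_idx T) :
    {additive tail_obj C -> copower_obj (P := P) phi} :=
  [the {additive _ -> _} of lin_ext (fun a : tail C =>
     [the {additive int -> copower_obj (P := P) phi} of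
       times_fun (@dsum_in A (fun b => P (phi b) : zmodType) (val a)
         (diff_class (phi (val a)) (val a)))])].

Lemma tail_to_copower_compat (C : csets A) (phi psi : pro_idx T)
    (c : shom phi psi) :
  @germ_eq Ab tails (T psi) C C
    (dmor T c \oc tail_to_copower_mor C phi) (tail_to_copower_mor C psi).
Proof.
apply: germ_eq_heq; apply: additive_tail_eq => a z.
rewrite /= !lin_extU /= /times_fun raddfMz -(diff_class_dmor (c (val a))).
congr (_ *~ z); exact: (@copower_mor_in P A _ _ c (val a)).
Qed.

(** The generator [a] goes to the difference class in the summand of index
    [a]. *)
Definition tail_to_copower (C : csets A) : hom tails T :=
  @ProHom Ab tails T (fun=> C) (tail_to_copower_mor C)
    (@tail_to_copower_compat C).

(** The component at the function [a |-> {a}] is nonzero on the generators of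
    every level. *)
Lemma tail_to_copower_neq0 C : ~ (tail_to_copower C =c pro_zero tails T).
Proof.
have cs a : countable [set a : A] by exact: countable1.
move=> /(_ (fun a => cset (cs a)))[D [s [t E]]].
have [a Da] : exists a, ~ sval D a.
  apply: contrapT => /forallNP DA; apply: uncountableA.
  by apply: countable_subset (svalP D) => a _; exact: contrapT.
have aD : a \notin sval D by apply/negP => /set_mem.
have /= := E (mkmalgU (exist _ a aD : tail D) 1).
rewrite lin_extU lin_extU /= /times_fun mulr1z => /(congr1 (fun f => dcoord f a)).
rewrite /dcoord /= dsum_in_funE; exact: diff_class_neq0.
Qed.

(** Any morphism [w] that restricts to the pairing kills the images of the
    generators [a] outside [D] at the level [D]. *)
Lemma pairing_tail0 (w : hom T (proH 0 (fort_ssh R A) (malg A int))) C :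
  (forall m, w \oc copower_unit fort_thin m =c bar 0 (fort_sys R A) m) ->
  w \oc tail_to_copower C =c w \oc pro_zero tails T.
Proof.
move=> Ew D; set psi := ph_idx w D; set z0 := ph_idx (pro_zero tails T) psi.
(* The two composites live at the levels [C] and [z0]; the level [E] lies below
   both and below [D], so that its generators lie outside [D]. *)
pose E := cset (countable_setU (svalP D) (countable_setU (svalP C) (svalP z0))).
have EC : @shom (csets A) E C by move=> a Ca; right; left.
have Ez : @shom (csets A) E z0 by move=> a za; right; right.
exists E, EC, Ez; apply: (@additive_tail_eq _ _ (w D \oc tail_to_copower C psi
  \oc dmor tails EC) (w D \oc pro_zero tails T psi \oc dmor tails Ez)) => a z.
rewrite /= !lin_extU /= /times_fun raddf0 raddfMz.
set b := val a; have Db : ~ sval D b.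
  by move=> Db; have /negP := svalP a; apply; apply/mem_set; left.
suff -> : w D (@dsum_in A (fun c => P (psi c) : zmodType) b (diff_class (psi b) b)) = 0.
  by rewrite mul0rz.
have [k [s [t Ek]]] := Ew (mkmalgU b 1) D; have [u _] := unit_idxU (P := P) b psi.
have unitE := unit_morU fort_thin s (scomp u s) (diff_class k b).
have tb0 : dmor P t (diff_class k b) = 0 by rewrite diff_class_dmor diff_class_out.
rewrite -(diff_class_dmor (scomp u s)) -[X in w D X]unitE.
apply: etrans (Ek (diff_class k b)) _.
by rewrite /= -/(dmor P t _) tb0 raddf0.
Qed.

End NotMono.

(** Cantor's diagonal argument. *)
Lemma nat_bool_uncountable : ~ countable [set: nat -> bool].
Proof.
move=> /countable_injP[f f_inj].
(* The sequence [d] differs at [f s] from every sequence [s]. *)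
pose d n := `[< exists2 s, f s = n & ~~ s n >].
have [dd|dd] := boolP (d (f d)); last first.
  by have /asboolPn[] := dd; exists d.
have /asboolP[s fs ds] := dd.
by move: ds; rewrite (f_inj _ _ (mem_set Logic.I) (mem_set Logic.I) fs) dd.
Qed.

Theorem theorem1p3 (R : realType) : ~ UCF R AB.
Proof.
move=> /(_ 0)[mono _]; pose A : choiceType := nat -> bool.
have [w Ew _] := copower_tensorP (@fort_thin R A)
  (@bar_additive R 0 (malg A int) (fort_sys R A)).
pose C := cset (@countable0 A).
apply: (@tail_to_copower_neq0 R A nat_bool_uncountable C).
apply: (mono (fort_ssh R A) _ Logic.I (free_tensor A (@fort_thin R A)) w Ew).
exact: pairing_tail0 Ew.
Qed.
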